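(* Let $d\in\mathbb{N}^+$ and let $0<\alpha<1$ with $1>\alpha d$. Let $\{X(t):t\in\mathbb{R}\}$ be a $d$-dimensional fractional Brownian motion of Hurst index $\alpha$. Let $A\subset\mathbb{R}$ be an analytic set with $\dim_P A=\beta$. Then, almost surely, $$\dim_P X^*(A)\ge \max\left\{\frac{\beta d}{\alpha d+\beta(1-\alpha d)},\ \beta(d+1-\alpha d)\right\}.$$
   Context: $\dim_P$ denotes packing dimension. $X^*(t)=(t,X(t))$, so $X^*(A)$ is the graph of $X|_A$. A $d$-dimensional fractional Brownian motion of Hurst index $\alpha$ on $\mathbb{R}$ is $X=(X_1,\dots,X_d)$ with $X_i$ i.i.d. copies of a centered real Gaussian process $X_0$ with $X_0(0)=0$, almost surely continuous paths and $\mathrm{Cov}(X_0(t),X_0(s))=\frac12(|t|^{2\alpha}+|s|^{2\alpha}-|t-s|^{2\alpha})$. *)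

(* Defs.v *)
From HB Require Import structures.
From mathcomp Require Import all_boot all_order all_algebra.
From mathcomp Require Import all_classical all_reals all_analysis.
Set Implicit Arguments. Unset Strict Implicit. Unset Printing Implicit Defensive.
Import Order.TTheory GRing.Theory Num.Theory.
Import numFieldNormedType.Exports.
Local Open Scope classical_set_scope.
Local Open Scope ring_scope.

Definition covering_number {R : realType} {V : pseudoMetricType R}
  (E : set V) (r : R) : \bar R :=
  ereal_inf [set (n%:R)%:E | n in
    [set n : nat | exists c : 'I_n -> V, E `<=` \bigcup_(i in setT) ball (c i) r]].

Definition box_ratio {R : realType} {V : pseudoMetricType R}
  (E : set V) (r : R) : \bar R :=
  match covering_number E r with
  | EFin n => ((ln n) / (- ln r))%:E
  | _ => +oo%E
  end.

Definition upper_box_dim {R : realType} {V : pseudoMetricType R}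
  (E : set V) : \bar R :=
  ereal_inf [set ereal_sup [set box_ratio E r | r in `]0, delta[ ]
            | delta in `]0, 1[ ].

Definition packing_dim {R : realType} {V : pseudoMetricType R}
  (E : set V) : \bar R :=
  ereal_inf [set s | exists F : nat -> set V,
     E `<=` \bigcup_(i in setT) F i /\
     s = ereal_sup [set upper_box_dim (F i) | i in setT]].

Definition baire_continuous {R : realType} (f : (nat -> nat) -> R) : Prop :=
  forall (x : nat -> nat) (eps : R), 0 < eps ->
    exists n : nat, forall y : nat -> nat,
      (forall k, (k < n)%N -> y k = x k) -> `|f y - f x| < eps.

Definition analytic_set {R : realType} (A : set R) : Prop :=
  A = set0 \/ exists f : (nat -> nat) -> R, baire_continuous f /\ range f = A.

Definition centered_gaussian {R : realType} {dT : measure_display}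
  {T : measurableType dT} (P : probability T R) (Y : T -> R) (v : R) : Prop :=
  measurable_fun setT Y /\
  forall B : set R, measurable B ->
    P (Y @^-1` B) = (if v == 0 then \d_(0:R) B else normal_prob 0 (Num.sqrt v) B).

Definition fbm_cov {R : realType} (alpha : R) (t s : R) : R :=
  (`|t| `^ (2 * alpha) + `|s| `^ (2 * alpha) - `|t - s| `^ (2 * alpha)) / 2.

(** d-dimensional fractional Brownian motion of Hurst index alpha:
    the family (X_i(t))_{i,t} is jointly centered Gaussian with
    Cov(X_i(t), X_j(s)) = [i = j] fbm_cov alpha t s (so the coordinates are
    i.i.d. copies of a real fBm), X(0) = 0 and paths are continuous a.s. *)
Definition is_fbm {R : realType} {dT : measure_display} {T : measurableType dT}
  (P : probability T R) (d : nat) (alpha : R) (X : R -> T -> 'rV[R]_d) : Prop :=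
  (forall (n : nat) (ts : 'I_n -> R) (ix : 'I_n -> 'I_d) (cs : 'I_n -> R),
     centered_gaussian P
       (fun w => \sum_(k < n) cs k * X (ts k) w ord0 (ix k))
       (\sum_(j < n) \sum_(k < n)
          cs j * cs k * (if ix j == ix k then fbm_cov alpha (ts j) (ts k) else 0)))
  /\ {ae P, forall w, X 0 w = 0}
  /\ {ae P, forall w, continuous (fun t => X t w)}.

Definition graph_on {R : realType} {T : Type} (d : nat)
  (X : R -> T -> 'rV[R]_d) (w : T) (A : set R) : set (R * 'rV[R]_d) :=
  (fun t => (t, X t w)) @` A.

(* Main.v *)
Require Import Defs.
From HB Require Import structures.
From mathcomp Require Import all_boot all_order all_algebra.
From mathcomp Require Import all_classical all_reals all_analysis.
From mathcomp Require Import measurable_realfun.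
From mathcomp Require Import ring lra.
Set Implicit Arguments.
Unset Strict Implicit.
Unset Printing Implicit Defensive.
Import Order.TTheory GRing.Theory Num.Theory.
Import numFieldNormedType.Exports.
Local Open Scope classical_set_scope.
Local Open Scope ring_scope.

(** Let [g < beta]. If [E] has upper box dimension above [g], then at infinitely
    many scales [r] it contains [N ~ r^-g] points that are [r]-separated. Put
    [rho = r^theta] and count the pairs of these points whose graph points are
    [rho]-close, with the Gaussian kernel in place of the indicator. Since
    [X t - X s] is Gaussian of variance [|t - s|^(2 alpha)], the expected number
    of pairs is at most
    [N + N * \sum_(k <= m) rho^d (k r)^(- alpha d)] up to a constant, where [k]
    may be restricted to [k <= N] or to [k <= 4 rho / r]. As [alpha d < 1], this
    is [O(N)] when [theta d = alpha d + g (1 - alpha d)] in the first case and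
    when [theta (d + 1 - alpha d) = 1] in the second. By Markov's inequality and
    Cauchy-Schwarz, at infinitely many scales [rho] the graph over [E] needs
    almost [N = rho^-(g / theta)] balls, almost surely: this gives the two bounds
    for upper box dimensions.

    For packing dimension, write [A] as the image of the Baire space under a
    continuous map, delete the countably many cylinders whose images are covered
    by countably many sets of upper box dimension at most [g], and apply the box
    estimate simultaneously to the images of all cylinders of the remaining
    closed set. The Baire category theorem in that closed set shows that any
    countable cover of the graph over [A] has a member that is dense in the
    graph over one of these images. *)


(** * Integrals of derivatives over the whole line *)

Section integral_of_derivative.
Context {R : realType}.
Local Notation mu := (@lebesgue_measure R).

(** The fundamental theorem of calculus on [[-n, n]] and dominated convergence, with [|f|] as bound,
    make the integral the limit of [F n - F (- n)]. This serves as integration by parts on the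
    line. *)
Lemma Rintegral_is_derive_eq0 (F f : R -> R) :
  (forall x : R, is_derive x 1 F (f x)) -> continuous f ->
  mu.-integrable setT (EFin \o f) ->
  (F n%:R - F (- n%:R)) @[n --> \oo] --> (0 : R) ->
  \int[mu]_x f x = 0.
Proof.
move=> dF cf intf F0.
pose D n : set R := `[- n%:R, n%:R]%classic.
have mf : measurable_fun setT f by exact: continuous_measurable_fun.
have [|||||_ _ lim1] := @dominated_convergence _ _ _ mu setT measurableT
  (fun n => (EFin \o f) \_ (D n)) (EFin \o f) (abse \o (EFin \o f)).
- move=> n; apply/(measurable_restrictT _ _).1 => //; first exact: measurable_itv.
  by apply/measurable_EFinP; exact: measurable_funTS.
- exact/measurable_EFinP.
- apply: aeW => x _; apply: cvg_near_cst.
  exists (Num.truncn `|x|).+1 => // n /= xn.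
  rewrite patchE mem_set//= /D /= in_itv/= -ler_norml ltW//.
  apply: (lt_le_trans (truncnS_gt _)).
  by rewrite ler_nat.
- exact: integrable_abse.
- apply: aeW => x n _ /=; rewrite patchE; case: ifPn => // _.
  by rewrite abse0.
have lim2 : [sequence (\int[mu]_x ((EFin \o f) \_ (D n)) x)%E]_n @ \oo --> (0%:E : \bar R).
  have -> : [sequence (\int[mu]_x ((EFin \o f) \_ (D n)) x)%E]_n =
     EFin \o (fun n => F n%:R - F (- n%:R)).
    apply/funext => n /=; rewrite -integral_mkcond.
    have [->|n0] := eqVneq n 0%N.
      by rewrite /D oppr0 set_itv1 integral_set1 subrr.
    have n_gt0 : 0 < n%:R :> R by rewrite ltr0n lt0n.
    have FD x : derivable F x 1 by have [] := dF x.
    have Fc x : {for x, continuous F}.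
      exact/differentiable_continuous/derivable1_diffP.
    rewrite (@continuous_FTC2 _ f F)//.
    + by rewrite gtrN.
    + by apply: continuous_subspaceT => x; exact: cf.
    + split => //.
      * by apply: cvg_at_right_filter; exact: Fc.
      * by apply: cvg_at_left_filter; exact: Fc.
    + by move=> x _; rewrite derive1E; have [] := dF x.
  by apply: cvg_EFin => //; exact: nearW.
rewrite /Rintegral.
by rewrite (cvg_unique _ lim1 lim2).
Qed.

End integral_of_derivative.


(** * Fourier transform of the normal density *)

Section gaussian_fourier.
Context {R : realType}.
Local Notation mu := (@lebesgue_measure R).

Lemma is_derive_sinZ (y x : R) : is_derive x 1 (fun z : R => sin (y * z)) (y * cos (y * x)).
Proof.
have -> : (fun z : R => sin (y * z)) = sin \o (y \*: (@id R)) by [].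
by apply: is_derive_eq; rewrite mulrC /= /GRing.scale/= mulr1.
Qed.

Lemma is_derive_cosZ (y x : R) : is_derive x 1 (fun z : R => cos (y * z)) (- (y * sin (y * x))).
Proof.
have -> : (fun z : R => cos (y * z)) = cos \o (y \*: (@id R)) by [].
by apply: is_derive_eq; rewrite mulrC /= /GRing.scale/= mulr1 mulrN.
Qed.

Lemma is_derive1_continuous (f df : R -> R) :
  (forall x : R, is_derive x 1 f (df x)) -> continuous f.
Proof.
move=> fdf x; apply/differentiable_continuous/derivable1_diffP.
by have [] := fdf x.
Qed.

Lemma continuous_le_integrable (f g : R -> R) : continuous f ->
  mu.-integrable setT (EFin \o g) -> (forall x, `|f x| <= g x) ->
  mu.-integrable setT (EFin \o f).
Proof.
move=> cf ig fg; apply: (le_integrable measurableT _ _ ig).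
  by apply/measurable_EFinP; exact: continuous_measurable_fun.
by move=> x _ /=; rewrite lee_fin (le_trans (fg x))// ler_norm.
Qed.

Variable s : R.
Hypothesis s0 : 0 < s.
Local Notation p := (normal_pdf 0 s).

Lemma normal_pdf0E x : p x = normal_peak s * expR (- (x ^+ 2 / (2 * s ^+ 2))).
Proof.
rewrite normal_pdfE ?gt_eqF// /normal_fun subr0 mulNr; congr (_ * expR (- (_ / _))).
by rewrite mulr_natl.
Qed.

Lemma is_derive_normal_pdf (x : R) : is_derive x 1 p (- (x / s ^+ 2) * p x).
Proof.
have -> : p = normal_peak s \*:
    (expR \o ((- (2 * s ^+ 2)^-1) \*: ((@id R) ^+ 2))).
  apply/funext => y; rewrite normal_pdf0E; congr (_ * expR _).
  by rewrite /= exprfctE /GRing.scale/= mulNr mulrC.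
apply: is_derive_eq; rewrite /= /GRing.scale/= /= ?exprfctE mulr1 expr1.
have := lt0r_neq0 s0; move: (expR _) => e sn0; field.
by [].
Qed.

(** Half of the exponent absorbs [|x|]: completing a square gives [|x| <= s (1 + (x / (2 s))^2)],
    which is at most [s exp ((x / (2 s))^2)]. The other half is, up to a constant, the density of
    standard deviation [sqrt 2 * s]. *)
Lemma normal_pdf_dominates_id : exists2 C : R, 0 <= C &
  forall x, `|x| * p x <= C * normal_pdf 0 (Num.sqrt 2 * s) x.
Proof.
have s20 : 0 < Num.sqrt 2 * s by rewrite mulr_gt0// sqrtr_gt0.
have k0 : 0 < normal_peak (Num.sqrt 2 * s) by rewrite normal_peak_gt0// gt_eqF.
exists (s * normal_peak s / normal_peak (Num.sqrt 2 * s)).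
  by rewrite divr_ge0 ?ltW// mulr_gt0// normal_peak_gt0// gt_eqF.
move=> x; rewrite normal_pdf0E normal_pdfE ?gt_eqF// /normal_fun subr0 mulNr.
rewrite exprMn sqr_sqrtr// [leRHS]mulrA divfK ?gt_eqF//.
rewrite mulrCA [leRHS]mulrAC [leRHS]mulrC ler_pM2l ?normal_peak_gt0 ?gt_eqF//.
have -> : x ^+ 2 / (2 * s ^+ 2) = x ^+ 2 / (2 * s ^+ 2 *+ 2) + (x / (2 * s)) ^+ 2.
  by field; rewrite gt_eqF.
rewrite opprD expRD mulrCA [leRHS]mulrC ler_pM2l ?expR_gt0//.
rewrite expRN ler_pdivrMr ?expR_gt0//.
apply: (@le_trans _ _ (s * (1 + (x / (2 * s)) ^+ 2))); last first.
  by rewrite ler_pM2l// expR_ge1Dx.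
rewrite -subr_ge0.
have -> : s * (1 + (x / (2 * s)) ^+ 2) - `|x| = s * (1 - `|x| / (2 * s)) ^+ 2.
  rewrite -[in LHS](@real_normK _ (x / _)) ?num_real// normrM normfV.
  rewrite (@gtr0_norm _ (2 * s)) ?mulr_gt0//.
  by field; rewrite gt_eqF.
by rewrite mulr_ge0 ?sqr_ge0 ?ltW.
Qed.

Lemma integrable_idM_normal_pdf :
  mu.-integrable setT (EFin \o (fun x => `|x| * p x)).
Proof.
have [C C0 HC] := normal_pdf_dominates_id.
apply: (@le_integrable _ _ _ mu setT measurableT _
    (EFin \o (fun x => C * normal_pdf 0 (Num.sqrt 2 * s) x))).
- apply/measurable_EFinP/measurable_funM; last exact: measurable_normal_pdf.
  exact: normr_measurable.
- move=> x _ /=; rewrite lee_fin normrM normr_id (ger0_norm (normal_pdf_ge0 _ _ _)).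
  exact: le_trans (HC x) (ler_norm _).
- exact: (integrableZl measurableT C (integrable_normal_pdf 0 (Num.sqrt 2 * s))).
Qed.

(** Integration by parts, from [x p = - s^2 p']. *)
Lemma Rintegral_idM_sin_normal_pdf (y : R) :
  \int[mu]_x (x * sin (y * x) * p x) =
  s ^+ 2 * y * \int[mu]_x (cos (y * x) * p x).
Proof.
have pc : continuous p by apply: is_derive1_continuous is_derive_normal_pdf.
have cc : continuous (fun x : R => cos (y * x)).
  exact: is_derive1_continuous (is_derive_cosZ y).
have sc : continuous (fun x : R => sin (y * x)).
  exact: is_derive1_continuous (is_derive_sinZ y).
have i1 : mu.-integrable setT (EFin \o (fun x => cos (y * x) * p x)).
  apply: continuous_le_integrable (integrable_normal_pdf 0 s) _ => x.
    by apply: cvgM; [exact: cc|exact: pc].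
  rewrite normrM (ger0_norm (normal_pdf_ge0 _ _ _)).
  by rewrite ler_piMl ?cos_max ?normal_pdf_ge0.
have i2 : mu.-integrable setT (EFin \o (fun x => x * sin (y * x) * p x)).
  apply: continuous_le_integrable integrable_idM_normal_pdf _ => x.
    by apply: cvgM; [apply: cvgM; [exact: cvg_id|exact: sc]|exact: pc].
  rewrite !normrM (ger0_norm (normal_pdf_ge0 _ _ _)).
  by rewrite ler_wpM2r ?normal_pdf_ge0// ler_piMr ?sin_max.
(* [h] is the derivative of [sin (y x) p x]. *)
pose h x := y * (cos (y * x) * p x) - (s ^+ 2)^-1 * (x * sin (y * x) * p x).
have h0 : \int[mu]_x h x = 0.
  apply: (@Rintegral_is_derive_eq0 _ ((fun x => sin (y * x)) * p)).
  - move=> x.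
    apply: (is_derive_eq (is_deriveM (is_derive_sinZ y x) (is_derive_normal_pdf x))).
    by rewrite /h /GRing.scale/=; lra.
  - move=> x; apply: cvgB; apply: cvgM; try exact: cvg_cst.
      by apply: cvgM; [exact: cc|exact: pc].
    by apply: cvgM; [apply: cvgM; [exact: cvg_id|exact: sc]|exact: pc].
  - exact: (integrableB measurableT (integrableZl measurableT y i1)
      (integrableZl measurableT (s ^+ 2)^-1 i2)).
  (* Since [|x| |sin (y x) p x| <= K], the boundary terms at [n] and [- n] are of order [K / n]; the
     constant [4 K] leaves room for [n + 1 <= 2 n]. *)
  - have [C C0 HC] := normal_pdf_dominates_id.
    pose K := C * normal_peak (Num.sqrt 2 * s).
    have HK x : `|x| * `|sin (y * x) * p x| <= K.
      rewrite normrM (ger0_norm (normal_pdf_ge0 _ _ _)).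
      apply: (@le_trans _ _ (`|x| * p x)).
        by rewrite ler_wpM2l// ler_piMl ?normal_pdf_ge0 ?sin_max.
      apply: (le_trans (HC x)); rewrite ler_wpM2l// normal_pdf_ub//.
      by rewrite gt_eqF// mulr_gt0// sqrtr_gt0.
    apply/norm_cvg0P.
    have lim : (4 * K) * harmonic n @[n --> \oo] --> (0 : R).
      rewrite -(mulr0 (4 * K)).
      by apply: cvgM; [exact: cvg_cst|exact: cvg_harmonic].
    apply: (squeeze_cvgr _ (cvg_cst 0) lim); apply: nearW => n.
    rewrite normr_ge0/= /harmonic /= ler_pdivlMr ?ltr0Sn//.
    case: n => [|n]; first by rewrite oppr0 subrr normr0 mul0r mulr_ge0// mulr_ge0// normal_peak_ge0.
    apply: (@le_trans _ _ (`|sin (y * n.+1%:R) * p n.+1%:R - sin (y * - n.+1%:R) * p (- n.+1%:R)| * (2 * n.+1%:R))).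
      by rewrite ler_wpM2l// -natrM ler_nat mul2n -addnn addnS !addSn !ltnS leq_addr.
    have := HK n.+1%:R; have := HK (- n.+1%:R).
    rewrite normrN [`|n.+1%:R|]ger0_norm//.
    have := ler_normB (sin (y * n.+1%:R) * p n.+1%:R) (sin (y * - n.+1%:R) * p (- n.+1%:R)).
    have : 0 <= n.+1%:R :> R by [].
    set a := `|_ - _|; set b := `|_|; set c := `|_|; set m := n.+1%:R; nra.
move: h0; rewrite /h (RintegralB measurableT (integrableZl measurableT y i1)
  (integrableZl measurableT (s ^+ 2)^-1 i2)).
rewrite !RintegralZl// => /eqP; rewrite subr_eq0 => /eqP e.
by rewrite -mulrA e mulrA divff ?mul1r// expf_neq0// gt_eqF.
Qed.

(** Differentiation under the integral gives [F' z = - s^2 z F z], so [F z * exp (s^2 z^2 / 2)] is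
    constant, with value [1] at [0]. *)
Lemma Rintegral_cos_normal_pdf (y : R) :
  \int[mu]_x (cos (y * x) * p x) = expR (- (s ^+ 2 * y ^+ 2 / 2)).
Proof.
have pc : continuous p by apply: is_derive1_continuous is_derive_normal_pdf.
pose F z := \int[mu]_x (cos (z * x) * p x).
have dcos (z x : R) : is_derive z 1 (fun z : R => cos (z * x) * p x) (- (x * sin (z * x) * p x)).
  have -> : (fun z : R => cos (z * x) * p x) = (p x) \*: (fun z : R => cos (x * z)).
    by apply/funext => t; rewrite /= /GRing.scale/= mulrC (mulrC t).
  apply: (is_derive_eq (is_deriveZ (p x) (is_derive_cosZ x z))).
  by rewrite /GRing.scale/= (mulrC z); lra.
have dF (z : R) : is_derive z 1 F (- (s ^+ 2 * z * F z)).
  have zI : `]z - 1, z + 1[%classic z by rewrite /= in_itv/= ltrDl gtrDl ltrN10 ltr01.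
  have i1 t : `]z - 1, z + 1[%classic t ->
      mu.-integrable setT (EFin \o (fun x => cos (t * x) * p x)).
    move=> _; apply: continuous_le_integrable (integrable_normal_pdf 0 s) _ => x.
      apply: cvgM; last exact: pc.
      exact: is_derive1_continuous (is_derive_cosZ t) x.
    rewrite normrM (ger0_norm (normal_pdf_ge0 _ _ _)).
    by rewrite ler_piMl ?cos_max ?normal_pdf_ge0.
  have pE t x : partial1of2 (fun z x => cos (z * x) * p x) t x = - (x * sin (t * x) * p x).
    by rewrite partial1of2E; have [] := dcos t x.
  have d1 t x : `]z - 1, z + 1[%classic t -> [set: R] x ->
    derivable ((fun z x => cos (z * x) * p x) ^~ x) t 1.
    by move=> _ _; have [] := dcos t x.
  have G0 x : 0 <= `|x| * p x by rewrite mulr_ge0 ?normal_pdf_ge0.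
  have Gub t x : `]z - 1, z + 1[%classic t -> [set: R] x ->
     `|partial1of2 (fun z x => cos (z * x) * p x) t x| <= `|x| * p x.
    move=> _ _; rewrite pE normrN !normrM (ger0_norm (normal_pdf_ge0 _ _ _)).
    by rewrite ler_wpM2r ?normal_pdf_ge0// ler_piMr ?sin_max.
  apply: DeriveDef.
    exact: (derivable_under_integral measurableT zI i1 d1 G0 integrable_idM_normal_pdf Gub).
  rewrite -derive1E.
  rewrite (differentiation_under_integral measurableT zI i1 d1 G0 integrable_idM_normal_pdf Gub).
  under eq_Rintegral do rewrite pE -mulN1r.
  rewrite RintegralZl ?mulN1r ?Rintegral_idM_sin_normal_pdf//.
  apply: continuous_le_integrable integrable_idM_normal_pdf _ => x.
    apply: cvgM; last exact: pc.
    apply: cvgM; first exact: cvg_id.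
    exact: is_derive1_continuous (is_derive_sinZ z) x.
  rewrite !normrM (ger0_norm (normal_pdf_ge0 _ _ _)).
  by rewrite ler_wpM2r ?normal_pdf_ge0// ler_piMr ?sin_max.
pose E : R -> R := expR \o ((s ^+ 2 / 2) \*: ((@id R) ^+ 2)).
have dE (z : R) : is_derive z 1 E (s ^+ 2 * z * E z).
  apply: is_derive_eq; rewrite /E /= /GRing.scale/= ?exprfctE mulr1 expr1.
  by lra.
have dG (z : R) : is_derive z (1 : R) (F * E) 0.
  by apply: is_derive_eq; rewrite /GRing.scale/=; lra.
have := is_derive_0_is_cst y 0 dG.
have -> : (F * E) y = F y * E y by [].
have -> : (F * E) 0 = F 0 * E 0 by [].
have -> : F 0 = 1.
  rewrite /F; under eq_Rintegral do rewrite mul0r cos0 mul1r.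
  by rewrite /Rintegral integral_normal_pdf.
rewrite /E /= ?exprfctE /GRing.scale/= expr0n/= mulr0 expR0 mulr1 => H.
rewrite -/(F y) expRN; apply: (mulIf (lt0r_neq0 (expR_gt0 (s ^+ 2 / 2 * y ^+ 2)))).
by rewrite H mulrAC mulVf// gt_eqF// expR_gt0.
Qed.

End gaussian_fourier.


(** * Integrals against probability measures and the normal law *)

Section bounded_integrals.
Context {R : realType}.

Lemma bounded_prob_integrable d (T : measurableType d) (P : probability T R)
    (f : T -> R) (M : R) :
  measurable_fun setT f -> (forall x, `|f x| <= M) ->
  P.-integrable setT (EFin \o f).
Proof.
move=> mf fM; apply: measurable_bounded_integrable => //.
  by rewrite [ltLHS](@probability_setT _ _ _ P) ltry.
exists M; split; first exact: num_real.
by move=> y My x _; exact: le_trans (fM x) (ltW My).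
Qed.

Lemma bounded_Rintegral_Fubini d1 d2 (T1 : measurableType d1) (T2 : measurableType d2)
    (P : probability T1 R) (Q : probability T2 R) (f : T1 * T2 -> R) (M : R) :
  measurable_fun setT f -> (forall x, `|f x| <= M) ->
  \int[P]_x \int[Q]_y f (x, y) = \int[Q]_y \int[P]_x f (x, y).
Proof.
move=> mf fM.
have intf : (P \x Q)%E.-integrable setT (EFin \o f).
  exact: bounded_prob_integrable mf fM.
have m1 x : measurable_fun setT (fun y => f (x, y)) by exact: measurableT_comp.
have m2 y : measurable_fun setT (fun x => f (x, y)) by exact: measurableT_comp.
have i1 x : Q.-integrable setT (EFin \o (fun y => f (x, y))).
  exact: bounded_prob_integrable (m1 x) (fun y => fM (x, y)).
have i2 y : P.-integrable setT (EFin \o (fun x => f (x, y))).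
  exact: bounded_prob_integrable (m2 y) (fun x => fM (x, y)).
rewrite /Rintegral.
under eq_integral.
  move=> x _; rewrite fineK; last first.
    by apply: integrable_fin_num => //; exact: i1.
  over.
under [in RHS]eq_integral.
  move=> y _; rewrite fineK; last first.
    by apply: integrable_fin_num => //; exact: i2.
  over.
by rewrite -(Fubini intf).
Qed.

End bounded_integrals.

Section normal_law.
Context {R : realType}.
Local Notation mu := (@lebesgue_measure R).

(** The Radon-Nikodym derivative of the normal law and [normal_pdf] have equal integrals over
    measurable sets, hence agree almost everywhere. *)
Lemma Rintegral_normal_prob (s : R) (f : R -> R) (M : R) :
  measurable_fun setT f -> (forall x, `|f x| <= M) ->
  \int[normal_prob 0 s]_x f x = \int[mu]_x (f x * normal_pdf 0 s x).
Proof.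
move=> mf fM.
have intf := @bounded_prob_integrable _ _ _ (normal_prob 0 s) _ _ mf fM.
have dom := @normal_prob_dominates R 0 s.
rewrite /Rintegral; congr fine.
rewrite -(Radon_Nikodym_change_of_variables dom)//=.
apply: ae_eq_integral => //.
- apply: emeasurable_funM; first exact/measurable_EFinP.
  by apply: (measurable_int mu); exact: Radon_Nikodym_integrable.
- apply/measurable_EFinP/measurable_funM => //; exact: measurable_normal_pdf.
- apply: (ae_eq_trans _ (ae_eq_refl _ _ _)).
  rewrite (_ : (fun x => (f x * normal_pdf 0 s x)%:E) = (fun x => (f x)%:E * (normal_pdf 0 s x)%:E)%E)//.
  apply: ae_eqe_mul2l => /=.
  apply: integral_ae_eq => //=.
  + exact: Radon_Nikodym_integrable.
  + by apply/measurable_EFinP; exact: measurable_normal_pdf.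
  + by move=> E _ mE; rewrite -Radon_Nikodym_integral.
Qed.

Lemma Rintegral_cos_normal_prob (s y : R) : 0 < s ->
  \int[normal_prob 0 s]_x cos (y * x) = expR (- (s ^+ 2 * y ^+ 2 / 2)).
Proof.
move=> s0; rewrite (@Rintegral_normal_prob _ _ 1) ?Rintegral_cos_normal_pdf//.
  apply: continuous_measurable_fun.
  exact: is_derive1_continuous (is_derive_cosZ y).
by move=> x; exact: cos_max.
Qed.

Lemma Rintegral_expR_normal_prob (v : R) : 0 <= v ->
  \int[normal_prob 0 1]_x expR (- (v * x ^+ 2 / 2)) = (Num.sqrt (1 + v))^-1.
Proof.
move=> v0; rewrite (@Rintegral_normal_prob _ _ 1); last 2 first.
- apply: measurableT_comp => //; apply: measurableT_comp => //.
  by apply: measurable_funM => //; apply: measurable_funM.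
- move=> x; rewrite ger0_norm ?expR_ge0// -expR0 ler_expR.
  by rewrite oppr_le0 divr_ge0// mulr_ge0// sqr_ge0.
(* The integrand times the standard density is [s] times the normal density of variance
   [1 / (1 + v)]. *)
set s := (Num.sqrt (1 + v))^-1.
have v1 : 0 < 1 + v by rewrite ltr_pwDl.
have s0 : 0 < s by rewrite invr_gt0 sqrtr_gt0.
transitivity (\int[mu]_x (s * normal_pdf 0 s x)); last first.
  rewrite RintegralZl//; last exact: integrable_normal_pdf.
  by rewrite /Rintegral integral_normal_pdf mulr1.
apply: eq_Rintegral => x _; rewrite !normal_pdf0E// mulrCA -expRD.
have s2 : s ^+ 2 = (1 + v)^-1 by rewrite exprVn sqr_sqrtr// ltW.
have -> : normal_peak 1 = s * normal_peak s.
  rewrite /normal_peak expr1n mul1r -[_ *+ 2 in RHS]mulrnAr sqrtrM ?sqr_ge0// sqrtr_sqr gtr0_norm// invfM mulrA.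
  by rewrite divff ?mul1r// gt_eqF.
rewrite mulrA; congr (_ * expR _); rewrite s2.
by field; rewrite gt_eqF.
Qed.

Lemma expectation_cos_centered_gaussian d (T : measurableType d)
    (P : probability T R) (Y : T -> R) (v : R) : 0 <= v ->
  centered_gaussian P Y v -> \int[P]_w cos (Y w) = expR (- (v / 2)).
Proof.
move=> v0 [mY HY].
have mcos : measurable_fun setT (@cos R).
  by apply: continuous_measurable_fun; exact: continuous_cos.
have mcosE : measurable_fun setT (EFin \o @cos R) by exact/measurable_EFinP.
have iY : P.-integrable setT (EFin \o (@cos R \o Y)).
  apply: (bounded_prob_integrable P (M := 1)); first exact: measurableT_comp.
  by move=> x; exact: cos_max.
rewrite /Rintegral.
(* At variance [0] the law is the Dirac mass at [0]. *)
have [v00|vn0] := eqVneq v 0.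
  rewrite -[X in fine X](integral_pushforward mY mcosE iY measurableT).
  rewrite v00 mul0r oppr0 expR0.
  rewrite (@eq_measure_integral _ _ _ _ (\d_(0 : R)))/=; last first.
    by move=> A mA _; rewrite -[LHS]/(P (Y @^-1` A)) HY// v00 eqxx.
  by rewrite integral_dirac//= indicT mul1r cos0.
have sv0 : 0 < Num.sqrt v by rewrite sqrtr_gt0 lt0r vn0.
have := Rintegral_cos_normal_prob 1 sv0.
rewrite expr1n mulr1 sqr_sqrtr// => <-.
rewrite /Rintegral.
rewrite -[X in fine X = _](@integral_pushforward _ _ T (measurableTypeR R) R Y mY
  P setT _ mcosE iY measurableT).
congr fine; transitivity (\int[normal_prob 0 (Num.sqrt v)]_y (cos y)%:E)%E.
  apply: eq_measure_integral => A mA _.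
  by rewrite -[LHS]/(P (Y @^-1` A)) HY// (negbTE vn0).
by apply: eq_integral => x _; rewrite mul1r.
Qed.

End normal_law.

(** * Expectations of products of Gaussian kernels *)

Lemma mulr_cosM {R : realType} (h x y : R) :
  h * cos x * cos y = 2^-1 * (h * cos (y + x) + h * cos (y - x)).
Proof. by rewrite cosD cosB; lra. Qed.

Section gaussian_product.
Context {R : realType} d (T : measurableType d) (P : probability T R).
Variable v : R.
Hypothesis v0 : 0 <= v.

(** The characteristic function of the standard normal law, so that its expectation reduces to
    expectations of cosines. *)
Definition gauss_kernel (y : R) : R := expR (- (y ^+ 2 / 2)).

Lemma measurable_gauss_kernel : measurable_fun setT gauss_kernel.
Proof.
by apply: measurableT_comp => //; apply: measurableT_comp => //; exact: measurable_funM.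
Qed.

Lemma gauss_kernel_ge0 y : 0 <= gauss_kernel y.
Proof. exact: expR_ge0. Qed.

Lemma gauss_kernel_le1 y : gauss_kernel y <= 1.
Proof. by rewrite -expR0 ler_expR oppr_le0 divr_ge0 ?sqr_ge0. Qed.

(** The kernel at [Y w] is the mean of [cos (u * Y w)] over a standard normal [u]. After Fubini, the
    product formula leaves the phases [S + u Y] and [S - u Y], whose integrals agree because the
    given value is even in [u]. Averaging over [u] yields [1 / sqrt (1 + v)]. *)
Lemma Rintegral_gauss_kernelM (H Y S : T -> R) (M a : R) :
  measurable_fun setT H -> measurable_fun setT Y -> measurable_fun setT S ->
  (forall w, `|H w| <= M) ->
  (forall u, \int[P]_w (H w * cos (S w + u * Y w)) = a * expR (- (v * u ^+ 2 / 2))) ->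
  \int[P]_w (H w * gauss_kernel (Y w) * cos (S w)) = a / Num.sqrt (1 + v).
Proof.
move=> mH mY mS HM HS.
have mcos : measurable_fun setT (@cos R).
  by apply: continuous_measurable_fun; exact: continuous_cos.
have M0 w : 0 <= M := le_trans (normr_ge0 _) (HM w).
have intS u : P.-integrable setT (EFin \o (fun w => H w * cos (S w + u * Y w))).
  apply: (bounded_prob_integrable P (M := M)).
    apply: measurable_funM => //; apply: measurableT_comp => //.
    by apply: measurable_funD => //; exact: measurable_funM.
  by move=> w; rewrite normrM -[leRHS]mulr1 ler_pM// cos_max.
pose f (z : T * measurableTypeR R) := H z.1 * cos (z.2 * Y z.1) * cos (S z.1).
have fM z : `|f z| <= M.
  rewrite /f !normrM -[leRHS]mulr1 ler_pM// ?cos_max//.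
  by rewrite -[leRHS]mulr1 ler_pM// cos_max.
have mf : measurable_fun setT f.
  have m1 (g : T -> R) : measurable_fun setT g ->
    measurable_fun setT (fun z : T * measurableTypeR R => g z.1).
    by move=> mg; exact: (measurableT_comp mg measurable_fst).
  apply: measurable_funM; last exact: (m1 _ (measurableT_comp mcos mS)).
  apply: measurable_funM; first exact: m1.
  apply: measurableT_comp => //; apply: measurable_funM; last exact: m1.
  exact: measurable_snd.
transitivity (\int[P]_w \int[normal_prob 0 1]_u f (w, u)).
  apply: eq_Rintegral => w _; rewrite /f /=.
  under eq_Rintegral do rewrite (mulrC (H w)) -mulrA mulrC.
  rewrite RintegralZl//; last first.
    apply: (bounded_prob_integrable (normal_prob 0 1) (M := 1)).
      by apply: measurableT_comp => //; exact: measurable_funM.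
    by move=> u; exact: cos_max.
  under eq_Rintegral do rewrite mulrC.
  rewrite Rintegral_cos_normal_prob// expr1n mul1r /gauss_kernel.
  by rewrite mulrAC.
rewrite (bounded_Rintegral_Fubini P (normal_prob 0 1) mf fM).
transitivity (\int[normal_prob 0 1]_u (a * expR (- (v * u ^+ 2 / 2)))); last first.
  rewrite RintegralZl ?Rintegral_expR_normal_prob//.
  apply: (bounded_prob_integrable (normal_prob 0 1) (M := 1)).
    apply: measurableT_comp => //; apply: measurableT_comp => //.
    by apply: measurable_funM => //; exact: measurable_funM.
  move=> x; rewrite ger0_norm ?expR_ge0// -expR0 ler_expR.
  by rewrite oppr_le0 divr_ge0// mulr_ge0// sqr_ge0.
apply: eq_Rintegral => u _.
transitivity (2^-1 * \int[P]_w (H w * cos (S w + u * Y w) + H w * cos (S w + (- u) * Y w))).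
  rewrite -RintegralZl//; last first.
    exact: (integrableD measurableT (intS u) (intS (- u))).
  apply: eq_Rintegral => w _; rewrite /f /= mulNr.
  exact: mulr_cosM.
rewrite (RintegralD measurableT (intS u) (intS (- u))) !HS sqrrN.
by move: (a * _) => b; rewrite -mulr2n -[b *+ 2]mulr_natl mulKf// pnatr_eq0.
Qed.

(** Induction on [n]. In each step [H] takes in one kernel, and the one-kernel lemma is applied with
    the linear combination of the remaining variables added to the phase. *)
Lemma Rintegral_prod_gauss_kernel n (Y : nat -> T -> R) (H S : T -> R) (M a : R) :
  measurable_fun setT H -> (forall i, measurable_fun setT (Y i)) ->
  measurable_fun setT S -> (forall w, `|H w| <= M) ->
  (forall c : nat -> R,
    \int[P]_w (H w * cos (S w + \sum_(i < n) c i * Y i w)) =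
    a * expR (- (v * (\sum_(i < n) c i ^+ 2) / 2))) ->
  \int[P]_w (H w * (\prod_(i < n) gauss_kernel (Y i w)) * cos (S w)) =
    a / Num.sqrt (1 + v) ^+ n.
Proof.
elim: n Y H S M a => [|n IH] Y H S M a mH mY mS HM HS.
  have := HS (fun=> 0); rewrite big_ord0 mulr0 mul0r oppr0 expR0 mulr1 expr0 divr1 => <-.
  by apply: eq_Rintegral => w _; rewrite !big_ord0 mulr1 addr0.
have mcsum (c : nat -> R) (Z : nat -> T -> R) k : (forall i, measurable_fun setT (Z i)) ->
    measurable_fun setT (fun w => \sum_(i < k) c i * Z i w).
  by move=> mZ; apply: measurable_sum => i; apply: measurable_funM; [exact: measurable_cst|exact: mZ].
have -> : a / Num.sqrt (1 + v) ^+ n.+1 = (a / Num.sqrt (1 + v)) / Num.sqrt (1 + v) ^+ n.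
  by rewrite exprS invfM mulrA.
have mH' : measurable_fun setT (fun w => H w * gauss_kernel (Y 0%N w)).
  apply: measurable_funM => //; apply: measurableT_comp => //.
  exact: measurable_gauss_kernel.
rewrite -(IH (fun i => Y i.+1) _ S M _ mH' (fun i => mY i.+1) mS).
- apply: eq_Rintegral => w _; rewrite big_ord_recl/= !mulrA; congr (_ * _ * _).
- move=> w; rewrite normrM -[leRHS]mulr1 ler_pM//.
  by rewrite ger0_norm ?gauss_kernel_ge0 ?gauss_kernel_le1.
- move=> c; set k := expR _.
  rewrite mulrAC.
  apply: (Rintegral_gauss_kernelM (M := M)) => //.
    by apply: measurable_funD => //; exact: (mcsum c (fun i => Y i.+1)).
  (* [u] becomes the coefficient of [Y 0], and [c] is shifted by one. *)
  move=> u; have := HS (fun i => if i is i'.+1 then c i' else u).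
  rewrite big_ord_recl/= mulrDr mulrDl opprD expRD mulrA mulrAC => <-.
  by apply: eq_Rintegral => w _; rewrite big_ord_recl/= addrA addrAC.
Qed.

End gaussian_product.


(** * Increments of fractional Brownian motion *)

Section fbm_increments.
Context {R : realType}.

Lemma fbm_cov_increment (alpha t s : R) : alpha != 0 ->
  fbm_cov alpha t t - fbm_cov alpha t s - fbm_cov alpha s t + fbm_cov alpha s s =
  `|t - s| `^ (2 * alpha).
Proof.
move=> a0; rewrite /fbm_cov !subrr normr0 powR0 ?mulf_neq0// (distrC s t); lra.
Qed.

Lemma sqrtr_powR_expr (x alpha : R) n : 0 < x ->
  (Num.sqrt (x `^ (2 * alpha)) ^+ n) = x `^ (alpha * n%:R).
Proof.
move=> x0; rewrite [in RHS]powRrM powR_mulrn ?powR_ge0//; congr (_ ^+ n).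
by rewrite mulrC powRrM powR_mulrn ?powR_ge0// sqrtr_sqr ger0_norm// powR_ge0.
Qed.

(** Dropping the [1] under the root leaves [x^alpha / rho]. The left side is the expected kernel of
    an increment over a time [x]. *)
Lemma small_ball_bound (x alpha rho : R) n : 0 < x -> 0 < rho ->
  (Num.sqrt (1 + x `^ (2 * alpha) / rho ^+ 2) ^+ n)^-1 <=
  rho ^+ n * x `^ (- (alpha * n%:R)).
Proof.
move=> x0 r0.
have xa0 : 0 < x `^ (2 * alpha) by rewrite powR_gt0.
rewrite powRN -sqrtr_powR_expr// -[rho ^+ n]invrK -invfM lef_pV2 ?posrE; last 2 first.
- by rewrite exprn_gt0// sqrtr_gt0 ltr_wpDr// divr_ge0// ?ltW// exprn_gt0.
- by rewrite mulr_gt0 ?invr_gt0 ?exprn_gt0// sqrtr_gt0.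
rewrite -exprVn -exprMn; apply: lerXn2r.
- by rewrite nnegrE mulr_ge0 ?sqrtr_ge0// invr_ge0 ltW.
- by rewrite nnegrE sqrtr_ge0.
have -> : rho^-1 = Num.sqrt ((rho^-1) ^+ 2) by rewrite sqrtr_sqr ger0_norm// invr_ge0 ltW.
rewrite -sqrtrM ?sqr_ge0// ler_wsqrtr// exprVn mulrC.
by rewrite lerDr.
Qed.

Context d (T : measurableType d) (P : probability T R).

Lemma fbm_increment_gaussian n (alpha : R) (X : R -> T -> 'rV[R]_n)
    (t s : R) (c : 'I_n -> R) : alpha != 0 -> is_fbm P alpha X ->
  centered_gaussian P
    (fun w => \sum_(i < n) c i * (X t w ord0 i - X s w ord0 i))
    ((\sum_(i < n) c i ^+ 2) * `|t - s| `^ (2 * alpha)).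
Proof.
move=> a0 [HX _].
(* The combination is spread over [n + n] indices: coefficients [c] at time [t], then [- c] at time
   [s]. *)
pose ts (k : 'I_(n + n)) := match fintype.split k with inl _ => t | inr _ => s end.
pose ix (k : 'I_(n + n)) := match fintype.split k with inl i => i | inr i => i end.
pose cs (k : 'I_(n + n)) := match fintype.split k with inl i => c i | inr i => - c i end.
have tl i : ts (lshift n i) = t by rewrite /ts (unsplitK (inl i)).
have tr i : ts (rshift n i) = s by rewrite /ts (unsplitK (inr i)).
have il i : ix (lshift n i) = i by rewrite /ix (unsplitK (inl i)).
have ir i : ix (rshift n i) = i by rewrite /ix (unsplitK (inr i)).
have cl i : cs (lshift n i) = c i by rewrite /cs (unsplitK (inl i)).
have cr i : cs (rshift n i) = - c i by rewrite /cs (unsplitK (inr i)).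
have := HX _ ts ix cs; congr centered_gaussian.
  apply/funext => w; rewrite big_split_ord/= -big_split/=.
  by apply: eq_bigr => i _; rewrite tl tr il ir cl cr mulrBr mulNr.
have sum1 i (a b : R) : \sum_(j < n) a * c j * (if i == j then b else 0) = a * c i * b.
  rewrite (bigD1 i)//= eqxx big1 ?addr0// => j ji.
  by rewrite eq_sym (negbTE ji) mulr0.
have sum1N i (a b : R) : \sum_(j < n) a * (- c j) * (if i == j then b else 0) = - (a * c i * b).
  under eq_bigr do rewrite mulrN mulNr.
  by rewrite sumrN sum1.
rewrite big_split_ord/= -big_split/= mulr_suml; apply: eq_bigr => i _.
rewrite !big_split_ord/= -(fbm_cov_increment t s a0).
transitivity ((c i * c i * fbm_cov alpha t t + - (c i * c i * fbm_cov alpha t s)) +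
   ((- c i) * c i * fbm_cov alpha s t + - ((- c i) * c i * fbm_cov alpha s s))).
  congr (_ + _ + (_ + _)); [rewrite -sum1|rewrite -sum1N|rewrite -sum1|rewrite -sum1N];
    by apply: eq_bigr => j _; rewrite !(tl, tr, il, ir, cl, cr).
rewrite !mulNr opprK -expr2 -addrA -!mulrN -!mulrDr; congr (_ * _).
by rewrite !addrA.
Qed.

(* Only the laws of linear combinations are given; they determine this
   expectation through the Fourier representation of the kernel, without the
   joint density. *)
Lemma expectation_gauss_kernel_fbm n (alpha : R) (X : R -> T -> 'rV[R]_n)
    (t s rho : R) : (0 < n)%N -> alpha != 0 -> is_fbm P alpha X ->
  \int[P]_w (\prod_(i < n) gauss_kernel ((X t w ord0 i - X s w ord0 i) / rho)) =
  (Num.sqrt (1 + `|t - s| `^ (2 * alpha) / rho ^+ 2) ^+ n)^-1.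
Proof.
case: n X => // n X _ a0 HX.
set v := _ / rho ^+ 2.
have v0 : 0 <= v by rewrite divr_ge0 ?powR_ge0 ?sqr_ge0.
have mX u i : measurable_fun setT (fun w => X u w ord0 i).
  have [+ _] := HX.1 1%N (fun=> u) (fun=> i) (fun=> 1).
  by under eq_fun do rewrite big_ord1 mul1r.
pose Y k w := (X t w ord0 (inord k) - X s w ord0 (inord k)) / rho.
have mY k : measurable_fun setT (Y k).
  by apply: measurable_funM => //; exact: measurable_funB.
have := @Rintegral_prod_gauss_kernel R _ T P v v0 n.+1 Y (cst 1) (cst 0) 1 1.
rewrite mul1r => <- //; last 2 first.
- by move=> w; rewrite /= normr1.
- move=> c /=.
  have G := fbm_increment_gaussian t s (fun i => c i / rho) a0 HX.
  have vE : (\sum_(i < n.+1) (c i / rho) ^+ 2) * `|t - s| `^ (2 * alpha) =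
      v * \sum_(i < n.+1) c i ^+ 2.
    rewrite /v mulrC [in RHS]mulrAC -[in RHS]mulrA; congr (_ * _).
    by rewrite mulr_suml; apply: eq_bigr => i _; rewrite exprMn exprVn.
  rewrite mul1r -vE -(expectation_cos_centered_gaussian _ G); last first.
    by rewrite mulr_ge0 ?powR_ge0// sumr_ge0// => i _; exact: sqr_ge0.
  apply: eq_Rintegral => w _; rewrite mul1r add0r; congr cos.
  by apply: eq_bigr => i _; rewrite /Y inord_val mulrAC mulrA.
apply: eq_Rintegral => w _; rewrite mul1r cos0 mulr1.
by apply: eq_bigr => i _; rewrite /Y inord_val.
Qed.


End fbm_increments.


(** * Sums of negative powers and pairs in fibres *)

Section power_sums.
Context {R : realType}.

(** Young's inequality for [z^p] and [1], with conjugate exponents [1 / p] and [1 / (1 - p)]. *)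
Lemma powR_le_tangent1 (z p : R) : 0 <= z -> 0 < p < 1 -> z `^ p <= 1 - p + p * z.
Proof.
move=> z0 /andP[p0 p1].
have q0 : 0 < 1 - p by rewrite subr_gt0.
have := @conjugate_powR R (z `^ p) 1 p^-1 (1 - p)^-1 (powR_ge0 _ _) ler01.
rewrite !invr_gt0 !invrK -powRrM divff ?gt_eqF// powRr1// powR1 mul1r mulr1.
by move=> /(_ p0 q0); rewrite addrC subrK => /(_ erefl); rewrite addrC mulrC.
Qed.

(** Comparison with the integral of [x^-a]: the tangent bound at [z = n / (n + 1)] shows that each
    new term is at most the increment of the right side. *)
Lemma sum_powRN_le (a : R) n : 0 < a < 1 ->
  \sum_(k < n) k.+1%:R `^ (- a) <= n%:R `^ (1 - a) / (1 - a) :> R.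
Proof.
move=> /andP[a0 a1]; have q0 : 0 < 1 - a by rewrite subr_gt0.
elim: n => [|n IH].
  by rewrite big_ord0 divr_ge0 ?powR_ge0 ?ltW.
rewrite big_ord_recr/=; apply: (le_trans (lerD IH (lexx _))).
rewrite ler_pdivlMr// mulrDl divfK ?gt_eqF//.
have x0 : 0 < n.+1%:R :> R by [].
have z0 : 0 <= n%:R / n.+1%:R :> R by rewrite divr_ge0.
have q1 : 0 < 1 - a < 1 by rewrite q0 gtrBl.
have := powR_le_tangent1 z0 q1.
rewrite -(@ler_pM2l _ (n.+1%:R `^ (1 - a))) ?powR_gt0//.
rewrite -(powRM _ (ltW x0) z0) [n.+1%:R * _]mulrC divfK ?gt_eqF//.
have -> : n.+1%:R `^ (- a) = n.+1%:R `^ (1 - a) / n.+1%:R :> R.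
  by rewrite powRB ?gt_eqF ?implybT// powRr1// powRN mulrAC divff ?mul1r// gt_eqF.
move: (_ `^ _) (_ `^ _) => w u H; rewrite -(lerD2r (- (w / n.+1%:R * (1 - a)))) addrK.
apply: (le_trans H); rewrite le_eqVlt; apply/orP; left; apply/eqP.
rewrite -natr1 in x0 *; field; rewrite gt_eqF//.
Qed.

Lemma sum_pred1_le1 n (c : nat) : \sum_(j < n) (j == c :> nat)%:R <= 1 :> R.
Proof.
have [cn|nc] := ltnP c n.
  rewrite (bigD1 (Ordinal cn))//= eqxx big1 ?addr0// => j jc.
  rewrite (_ : (j == c :> nat) = false)//; apply/negbTE; apply: contra jc => /eqP jc.
  by apply/eqP/val_inj.
rewrite big1// => j _; rewrite (_ : (j == c :> nat) = false)//; apply/negbTE.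
by rewrite neq_ltn (leq_trans (ltn_ord j) nc).
Qed.

Definition ndist (i j : nat) := (maxn i j - minn i j)%N.

(** Only the indices [i + k + 1] and [i - k - 1] can lie at distance [k + 1] from [i]; hence the
    factor [2]. *)
Lemma sum_ndist_le (h : nat -> R) n m (i : 'I_n) (Q : pred 'I_n) :
  (forall k, 0 <= h k) -> (forall j, Q j -> ndist i j <= m)%N ->
  \sum_(j < n | (j != i) && Q j) h (ndist i j) <= 2 * \sum_(k < m) h k.+1.
Proof.
move=> h0 Qm.
(* Truncated subtraction may hit [j = 0] spuriously; this only adds nonnegative terms. *)
pose b (j k : nat) : R := (j == (i + k.+1)%N)%:R + (j == (i - k.+1)%N)%:R.
apply: (@le_trans _ _ (\sum_(j < n) \sum_(k < m) h k.+1 * b j k)).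
  rewrite big_mkcond/=; apply: ler_sum => j _.
  have b0 k : 0 <= h k.+1 * b j k by rewrite mulr_ge0// addr_ge0.
  case: ifPn => [/andP[ji Qj]|_]; last by apply: sumr_ge0 => k _.
  have := Qm _ Qj.
  have : (0 < ndist i j)%N.
    rewrite /ndist subn_gt0; case: (ltngtP i j) => // e.
    by rewrite (val_inj e) eqxx in ji.
  case E: (ndist i j) => [//|k] _ km.
  rewrite (bigD1 (Ordinal km))//= ler_wpDr//; first by apply: sumr_ge0 => ? _.
  rewrite ler_peMr// /b; move: E; rewrite /ndist.
  case: (ltngtP i j) => [ij|ij|e]; last by rewrite (val_inj e) eqxx in ji.
    by move=> <-; rewrite subnKC 1?ltnW// eqxx lerDl.
  by move=> <-; rewrite subKn 1?ltnW// eqxx lerDr.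
rewrite exchange_big/= mulr_sumr; apply: ler_sum => k _.
rewrite -mulr_sumr mulrC ler_wpM2r// /b big_split/=.
by rewrite (_ : 2 = 1 + 1)// lerD// sum_pred1_le1.
Qed.

(** Separation bounds [|x i - x j|] below by [r * ndist i j], and negative powers reverse the
    inequality. *)
Lemma sum_separated_le (x : nat -> R) (r a : R) n m (i : 'I_n) (Q : pred 'I_n) :
  0 < r -> 0 < a < 1 ->
  (forall j k, (j < k < n)%N -> r * (k - j)%:R <= x k - x j) ->
  (forall j, Q j -> ndist i j <= m)%N ->
  \sum_(j < n | (j != i) && Q j) `|x i - x j| `^ (- a) <=
  2 * (r `^ (- a) * (m%:R `^ (1 - a) / (1 - a))).
Proof.
move=> r0 a01 xr Qm; have a0 : 0 < a by case/andP: a01.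
have sepd (j : 'I_n) : r * (ndist i j)%:R <= `|x i - x j|.
  rewrite /ndist; case: (ltngtP i j) => [ij|ij|->].
  - by rewrite distrC (le_trans _ (ler_norm _))// xr// ij/=.
  - by rewrite (le_trans _ (ler_norm _))// xr// ij/=.
  - by rewrite subnn mulr0.
apply: (@le_trans _ _ (\sum_(j < n | (j != i) && Q j) r `^ (- a) * (ndist i j)%:R `^ (- a))).
  apply: ler_sum => j /andP[ji _].
  have nd0 : (0 < ndist i j)%N.
    rewrite /ndist subn_gt0; case: (ltngtP i j) => // e.
    by rewrite (val_inj e) eqxx in ji.
  have rn0 : 0 < r * (ndist i j)%:R by rewrite mulr_gt0// ltr0n.
  have xd0 : 0 < `|x i - x j| := lt_le_trans rn0 (sepd j).
  rewrite -(powRM _ (ltW r0) (ler0n _ _)) !powRN lef_pV2 ?posrE ?powR_gt0//.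
  by apply: ge0_ler_powR; rewrite ?nnegrE; [exact: ltW..|exact: sepd].
rewrite -mulr_sumr mulrCA ler_pM2l ?powR_gt0//.
apply: (le_trans (@sum_ndist_le (fun k => k%:R `^ (- a)) _ m i Q _ Qm)).
  by move=> k; exact: powR_ge0.
by rewrite ler_pM2l// sum_powRN_le.
Qed.

(* Cauchy-Schwarz on the sizes of the fibres of [c]. *)
Lemma sqr_card_le_fibre_pairs n m (c : 'I_n -> 'I_m) :
  n%:R ^+ 2 <= m%:R * \sum_(i < n) \sum_(j < n) (c i == c j)%:R :> R.
Proof.
have [m0|m0] := posnP m.
  case: n c => [|n] c; first by rewrite expr0n/= big_ord0 mulr0.
  by have := ltn_ord (c ord0); rewrite [X in (_ < X)%N]m0.
pose f (k : 'I_m) : R := \sum_(i < n) (c i == k)%:R.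
have fsum : \sum_k f k = n%:R.
  rewrite /f exchange_big/= -[n in RHS]card_ord -sumr_const; apply: eq_bigr => i _.
  by rewrite (bigD1 (c i))//= eqxx big1 ?addr0// => k; rewrite eq_sym => /negbTE ->.
have fsq : \sum_k f k ^+ 2 = \sum_(i < n) \sum_(j < n) (c i == c j)%:R.
  transitivity (\sum_k \sum_(i < n) \sum_(j < n) ((c i == k)%:R * (c j == k)%:R : R)).
    apply: eq_bigr => k _; rewrite expr2 /f mulr_suml; apply: eq_bigr => i _.
    by rewrite mulr_sumr.
  rewrite exchange_big/=; apply: eq_bigr => i _; rewrite exchange_big/=; apply: eq_bigr => j _.
  rewrite (bigD1 (c i))//= eqxx mul1r big1 ?addr0; first by rewrite eq_sym.
  by move=> k; rewrite eq_sym => /negbTE ->; rewrite mul0r.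
have mp : 0 < m%:R :> R by rewrite ltr0n.
(* [t] is the mean fibre size; the squared deviations from it have a nonnegative sum. *)
pose t : R := n%:R / m%:R.
have : 0 <= \sum_k (f k - t) ^+ 2 by apply: sumr_ge0 => k _; exact: sqr_ge0.
have -> : \sum_k (f k - t) ^+ 2 = \sum_k f k ^+ 2 - 2 * t * n%:R + m%:R * t ^+ 2.
  transitivity (\sum_k (f k ^+ 2 - 2 * t * f k + t ^+ 2)).
    by apply: eq_bigr => k _; ring.
  by rewrite big_split/= sumrB -mulr_sumr fsum sumr_const card_ord [m%:R * _]mulr_natl.
rewrite -fsq /t => H; rewrite -(@ler_pM2r _ m%:R^-1) ?invr_gt0// [leRHS]mulrAC divff ?gt_eqF// mul1r.
rewrite -subr_ge0; apply: (le_trans H); rewrite le_eqVlt; apply/orP; left; apply/eqP.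
by field; rewrite gt_eqF.
Qed.

End power_sums.

(** * Separated points and covering numbers *)

Section separated_points.
Context {R : realType}.

(** Greedy choice: if the balls around the separated points found so far do not cover [E], an
    uncovered point joins them. *)
Lemma separated_or_covered (E : set R) (r : R) n : 0 < r ->
  (exists s : seq R, [/\ size s = n.+1, uniq s, {in s, forall x, E x} &
     {in s &, forall x y, x != y -> r <= `|x - y|}]) \/
  (exists c : 'I_n -> R, E `<=` \bigcup_(i in setT) ball (c i) r).
Proof.
move=> r0; elim: n => [|n [[s [ss us sE sr]]|[c Ec]]].
- have [->|/set0P[x Ex]] := eqVneq E set0.
    by right; exists (fun=> 0) => x.
  left; exists [:: x]; split => //; first by move=> y /[!inE] /eqP ->.
  by move=> y z /[!inE] /eqP -> /eqP ->; rewrite eqxx.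
- have [cov|ncov] := pselect (E `<=` \bigcup_(i in setT) ball (nth 0 s (i : 'I_n.+1)) r).
    by right; exists (fun i => nth 0 s i).
  left; have [y [Ey yc]] : exists y, E y /\ forall x, x \in s -> r <= `|x - y|.
    apply: contrapT => /forallNP ny; apply: ncov => y Ey.
    have /not_andP[//|] := ny y => /existsNP[x /not_implyP[xs /negP]].
    rewrite -ltNge => xy.
    have xi : (index x s < n.+1)%N by rewrite -ss index_mem.
    by exists (Ordinal xi) => //=; rewrite nth_index.
  have yns : y \notin s.
    by apply/negP => /yc; rewrite subrr normr0 leNgt r0.
  exists (y :: s); split => /=; [by rewrite ss|by rewrite yns us| |].
  - by move=> x /[!inE] /predU1P[->//|/sE].
  - move=> x z /[!inE] /predU1P[->|xs] /predU1P[->|zs]; rewrite ?eqxx//.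
    + by move=> _; rewrite distrC yc.
    + by move=> _; rewrite yc.
    + exact: sr.
(* The [n] centres are padded with a dummy centre [0]. *)
- right; exists (fun i => if (i < n)%N =P true is ReflectT h then c (Ordinal h) else 0).
  move=> x /Ec[i _ xi]; exists (widen_ord (leqnSn n) i) => //=.
  case: eqP => [h|/negP]; last by rewrite ltn_ord.
  by rewrite (_ : Ordinal h = i)//; exact: val_inj.
Qed.

(** After sorting, consecutive gaps are at least [r], and gaps on the line add up. *)
Lemma separated_sorted (E : set R) (r : R) (s : seq R) : uniq s ->
  {in s, forall x, E x} -> {in s &, forall x y, x != y -> r <= `|x - y|} ->
  exists x : nat -> R, (forall i, (i < size s)%N -> E (x i)) /\
    (forall j k, (j < k < size s)%N -> r * (k - j)%:R <= x k - x j).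
Proof.
move=> us sE sr; pose t := sort <=%R s.
have tsz : size t = size s by rewrite size_sort.
have mt i : (i < size s)%N -> nth 0 t i \in s.
  by move=> si; rewrite -(mem_sort <=%R) mem_nth// tsz.
exists (nth 0 t); split => [i /mt /sE//|j k /andP[jk ks]].
have st : sorted <=%R t by apply: sort_sorted; exact: le_total.
have ut : uniq t by rewrite sort_uniq.
have le i : (i.+1 < size s)%N -> nth 0 t i <= nth 0 t i.+1.
  move=> si; have := @sorted_leq_nth _ _ (@le_trans _ R) (@lexx _ R) 0 t st i i.+1.
  by rewrite !inE tsz si (ltnW si) leqnSn; apply.
elim: k jk ks => // k IH; rewrite ltnS leq_eqVlt => /predU1P[->|jk] ks.
- rewrite subSnn mulr1.
  have ne : nth 0 t k.+1 != nth 0 t k.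
    by rewrite nth_uniq ?tsz// ?(ltnW ks)// -[k.+1]addn1 -[k in X in _ != X]addn0 eqn_add2l.
  by have := sr _ _ (mt _ ks) (mt _ (ltnW ks)) ne; rewrite ger0_norm// subr_ge0 le.
- have := IH jk (ltnW ks).
  have ne : nth 0 t k.+1 != nth 0 t k.
    by rewrite nth_uniq ?tsz// ?(ltnW ks)// -[k.+1]addn1 -[k in X in _ != X]addn0 eqn_add2l.
  have := sr _ _ (mt _ ks) (mt _ (ltnW ks)) ne; rewrite ger0_norm ?subr_ge0 ?le//.
  rewrite subSn 1?ltnW// -natr1 mulrDr mulr1; lra.
Qed.

Lemma covering_number_ge0 {V : pseudoMetricType R} (E : set V) (r : R) :
  (0 <= covering_number E r)%E.
Proof. by apply/le_ereal_inf_tmp => _ [n _ <-]; rewrite lee_fin. Qed.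

Lemma covering_number_le {V : pseudoMetricType R} (E : set V) (r : R) n (c : 'I_n -> V) :
  E `<=` \bigcup_(i in setT) ball (c i) r -> (covering_number E r <= n%:R%:E)%E.
Proof. by move=> Ec; apply: ereal_inf_lbound; exists n => //; exists c. Qed.

Lemma box_ratio_gt {V : pseudoMetricType R} (E : set V) (r g : R) : 0 < r < 1 -> 0 <= g ->
  (g%:E < box_ratio E r)%E -> ((r `^ (- g))%:E < covering_number E r)%E.
Proof.
move=> /andP[r0 r1] g0; have lr0 : 0 < - ln r by rewrite oppr_gt0 ln_lt0// r0.
rewrite /box_ratio; have := covering_number_ge0 E r.
case: covering_number => [n _| _ _|//]; last by rewrite ltry.
rewrite !lte_fin ltr_pdivlMr// => gn.
(* [ln] vanishes at nonpositive arguments, so [n <= 0] would contradict [0 <= g]. *)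
have n0 : 0 < n.
  rewrite ltNge; apply/negP => /ln0 n0; move: gn; rewrite n0 ltNge mulr_ge0//.
  exact: ltW.
rewrite -ltr_ln ?posrE ?powR_gt0// ln_powR mulNr -mulrN//.
Qed.

Lemma box_ratio_ge {V : pseudoMetricType R} (E : set V) (r b : R) : 0 < r < 1 ->
  ((r `^ (- b))%:E <= covering_number E r)%E -> (b%:E <= box_ratio E r)%E.
Proof.
move=> /andP[r0 r1]; have lr0 : 0 < - ln r by rewrite oppr_gt0 ln_lt0// r0.
rewrite /box_ratio; case: covering_number => [n| |]; rewrite ?leey//.
rewrite !lee_fin ler_pdivlMr// => bn.
have p0 : 0 < r `^ (- b) by rewrite powR_gt0.
have := bn; rewrite -ler_ln ?posrE//; last exact: lt_le_trans bn.
by rewrite ln_powR mulNr -mulrN.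
Qed.

Lemma upper_box_dim_gt {V : pseudoMetricType R} (E : set V) (g : R) :
  (g%:E < upper_box_dim E)%E ->
  forall delta, 0 < delta < 1 -> exists2 r, 0 < r < delta & (g%:E < box_ratio E r)%E.
Proof.
move=> gE delta d01; apply: contrapT => H.
move: gE; apply/negP; rewrite -leNgt.
apply: (@le_trans _ _ (ereal_sup [set box_ratio E r | r in `]0, delta[ ])).
  by apply: ereal_inf_lbound; exists delta => //=; rewrite in_itv.
apply: ge_ereal_sup => _ [r /= /[!in_itv]/= r01 <-]; rewrite leNgt; apply/negP => gr.
by apply: H; exists r.
Qed.

Lemma upper_box_dim_ge {V : pseudoMetricType R} (E : set V) (b : R) :
  (forall delta, 0 < delta < 1 -> exists2 r, 0 < r < delta & (b%:E <= box_ratio E r)%E) ->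
  (b%:E <= upper_box_dim E)%E.
Proof.
move=> H; apply/le_ereal_inf_tmp => _ [delta /= /[!in_itv]/= d01 <-].
have [r r01 br] := H _ d01; apply: (le_trans br).
by apply: ereal_sup_ubound; exists r => //=; rewrite in_itv.
Qed.

(** With [n] the integer part of [r^-g], the set cannot be covered by [n - 1] balls, which leaves
    [n] separated points. As [r^-g >= 1], [n] is within a factor [2] of it. *)
Lemma box_ratio_gt_separated (E : set R) (r g : R) : 0 < r < 1 -> 0 <= g ->
  (g%:E < box_ratio E r)%E ->
  exists (x : nat -> R) (n : nat), [/\ n%:R <= r `^ (- g), r `^ (- g) <= 2 * n%:R,
    (0 < n)%N, (forall i, (i < n)%N -> E (x i)) &
    (forall j k, (j < k < n)%N -> r * (k - j)%:R <= x k - x j)].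
Proof.
move=> r01 g0 /(box_ratio_gt r01 g0) cov.
have /andP[r0 r1] := r01.
have p1 : 1 <= r `^ (- g).
  rewrite powRN invf_ge1 ?powR_gt0// -(powRr0 r).
  by apply: ger_powR => //; rewrite r0 ltW.
pose n := Num.truncn (r `^ (- g)).
have nle : n%:R <= r `^ (- g) by rewrite truncn_le// (le_trans _ p1).
have nlt : r `^ (- g) < n.+1%:R by exact: truncnS_gt.
have n0 : (0 < n)%N by rewrite -ltnS -(ltr_nat R) (le_lt_trans p1 nlt).
have [[s [ss us sE sr]]|[c Ec]] := separated_or_covered E n.-1 r0.
  have [x [xE xr]] := separated_sorted us sE sr; exists x, n.
  move: xE xr; rewrite ss prednK// => xE xr; split => //.
  rewrite (le_trans (ltW nlt))// -natrM ler_nat; move: n0; case: (n) => // m _.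
  by rewrite mul2n -addnn addnS ltnS addSn ltnS leq_addr.
have := lt_le_trans cov (covering_number_le Ec); rewrite lte_fin => H.
by have := le_lt_trans nle H; rewrite ltr_nat ltnNge leq_pred.
Qed.

End separated_points.


(** * Energy of separated times *)

Section energy.
Context {R : realType}.

Lemma powR_le1 (r e : R) : 0 < r < 1 -> 0 <= e -> r `^ e <= 1.
Proof.
move=> /andP[r0 r1] e0; rewrite -(powRr0 r).
by apply: ger_powR => //; rewrite r0 ltW.
Qed.

(** In each regime the total power of [r] is nonnegative: it is [theta d - a - g (1 - a)] in the
    first and [theta (d + 1 - a) - 1] in the second, where a factor [4^(1 - a) <= 4] remains. *)
Lemma powR_scale_le4 (r a g theta : R) d m : 0 < r < 1 -> 0 < a < 1 -> 0 < theta ->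
  a + g * (1 - a) <= theta * d%:R /\ m%:R <= r `^ (- g) \/
  1 <= theta * (d%:R + 1 - a) /\ m%:R <= 4 * r `^ theta / r ->
  (r `^ theta) ^+ d * (r `^ (- a) * m%:R `^ (1 - a)) <= 4.
Proof.
move=> r01 /andP[a0 a1] t0; have /andP[r0 r1] := r01.
have rn0 : r != 0 by rewrite gt_eqF.
have q0 : 0 < 1 - a by rewrite subr_gt0.
have pD x y : r `^ x * r `^ y = r `^ (x + y) by rewrite powRD// rn0 implybT.
have m1 y : 0 < y -> m%:R <= y -> m%:R `^ (1 - a) <= y `^ (1 - a).
  by move=> y0 my; apply: ge0_ler_powR; rewrite ?nnegrE//; exact: ltW.
rewrite -powR_mulrn ?powR_ge0// -powRrM mulrA pD.
case=> -[H /m1 mle].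
  have {}mle : m%:R `^ (1 - a) <= r `^ (- g * (1 - a)).
    by rewrite powRrM mle// powR_gt0.
  apply: (le_trans (ler_wpM2l (powR_ge0 _ _) mle)); rewrite pD.
  by apply: (@le_trans _ _ 1); [apply: powR_le1 => //; lra|lra].
have {}mle : m%:R `^ (1 - a) <= 4 `^ (1 - a) * r `^ ((theta - 1) * (1 - a)).
  rewrite powRrM -powRM ?powR_ge0//.
  have -> : 4 * r `^ (theta - 1) = 4 * r `^ theta / r.
    by rewrite powRB ?rn0 ?implybT// powRr1 ?mulrA// ltW.
  by apply: mle; rewrite divr_gt0 ?mulr_gt0 ?powR_gt0.
apply: (le_trans (ler_wpM2l (powR_ge0 _ _) mle)); rewrite mulrCA pD.
have f4 : (4 : R) `^ (1 - a) <= 4.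
  rewrite -[leRHS]powRr1//; apply: ler_powR; lra.
rewrite -[leRHS]mulr1 ler_pM ?powR_ge0//; apply: powR_le1 => //; lra.
Qed.

(** The regimes bound the index distances differently: by [n] in the first, and by [4 r^theta / r],
    from separation and the cutoff, in the second. *)
Lemma separated_energy_le (x : nat -> R) (r a g theta : R) d n (i : 'I_n) :
  0 < r < 1 -> 0 < a < 1 -> 0 < theta ->
  (forall j k, (j < k < n)%N -> r * (k - j)%:R <= x k - x j) ->
  n%:R <= r `^ (- g) ->
  a + g * (1 - a) <= theta * d%:R \/ 1 <= theta * (d%:R + 1 - a) ->
  \sum_(j < n | (j != i) && (`|x i - x j| <= 4 * r `^ theta))
     (r `^ theta) ^+ d * `|x i - x j| `^ (- a) <= 8 / (1 - a).
Proof.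
move=> r01 a01 t0 xr ng H; have /andP[r0 r1] := r01.
have q0 : 0 < 1 - a by case/andP: a01 => *; rewrite subr_gt0.
have bound m : (forall j : 'I_n, `|x i - x j| <= 4 * r `^ theta -> (ndist i j <= m)%N) ->
    (r `^ theta) ^+ d * (r `^ (- a) * m%:R `^ (1 - a)) <= 4 ->
    \sum_(j < n | (j != i) && (`|x i - x j| <= 4 * r `^ theta))
     (r `^ theta) ^+ d * `|x i - x j| `^ (- a) <= 8 / (1 - a).
  move=> Qm m4; rewrite -mulr_sumr.
  apply: (le_trans (ler_wpM2l _ (sum_separated_le r0 a01 xr Qm))).
    by rewrite exprn_ge0// powR_ge0.
  move: m4; set u := _ ^+ d; set v := _ `^ (- a); set w := m%:R `^ (1 - a) => m4.
  have -> : u * (2 * (v * (w / (1 - a)))) = 2 * (u * (v * w)) / (1 - a) by ring.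
  by rewrite ler_pM2r ?invr_gt0//; lra.
case: H => H.
  apply: (bound n).
    move=> j _; rewrite /ndist (leq_trans (leq_subr _ _))// geq_max.
    by rewrite (ltnW (ltn_ord i)) (ltnW (ltn_ord j)).
  by apply: (@powR_scale_le4 _ _ g) => //; left.
apply: (bound (Num.truncn (4 * r `^ theta / r))).
  move=> j xij.
  have p0 : 0 <= 4 * r `^ theta / r by rewrite divr_ge0 ?mulr_ge0 ?powR_ge0 ?ltW.
  rewrite -ltnS -(ltr_nat R) (le_lt_trans _ (truncnS_gt _))// ler_pdivlMr// mulrC.
  apply: le_trans xij; rewrite /ndist; case: (ltngtP i j) => [ij|ij|->].
  - by rewrite distrC (le_trans _ (ler_norm _))// xr// ij/=.
  - by rewrite (le_trans _ (ler_norm _))// xr// ij/=.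
  - by rewrite subnn mulr0.
have p0 : 0 <= 4 * r `^ theta / r by rewrite divr_ge0 ?mulr_ge0 ?powR_ge0 ?ltW.
by apply: (@powR_scale_le4 _ _ g) => //; right; rewrite ?truncn_le.
Qed.

End energy.


(** * Pair energy against coverings of the graph *)

Section pair_energy.
Context {R : realType}.

(** A smooth count of [rho]-close pairs of graph points. The cutoff on times records closeness in
    the first coordinate of the graph and is what the second bound rests on. *)
Definition pair_energy d (f : R -> 'rV[R]_d) (x : nat -> R) (n : nat) (rho : R) : R :=
  \sum_(i < n) \sum_(j < n | `|x i - x j| <= 4 * rho)
    \prod_(l < d) gauss_kernel ((f (x i) ord0 l - f (x j) ord0 l) / rho).

Lemma gauss_kernel_ge (y : R) : `|y| <= 4 -> expR (- 8) <= gauss_kernel y.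
Proof.
rewrite ler_norml => /andP[? ?]; rewrite ler_expR; nra.
Qed.

(** A point of the closure lies within [2 rho] of a centre, so two points with the same centre are
    within [4 rho] in every coordinate. Such a pair passes the cutoff and contributes at least
    [exp (- 8)^d], as [4^2 / 2 = 8]; the number of these pairs is bounded below by
    Cauchy-Schwarz. *)
Lemma pair_energy_ge d (f : R -> 'rV[R]_d) (x : nat -> R) n (rho : R)
    (G : set (R * 'rV[R]_d)) m (c : 'I_m -> R * 'rV[R]_d) :
  0 < rho -> (forall i, (i < n)%N -> closure G (x i, f (x i))) ->
  G `<=` \bigcup_(i in setT) ball (c i) rho ->
  expR (- 8) ^+ d * n%:R ^+ 2 <= m%:R * pair_energy f x n rho.
Proof.
move=> r0 xG Gc.
have ex (i : 'I_n) : exists k, ball (c k) (rho + rho) (x i, f (x i)).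
  have [q [Gq bq]] := xG i (ltn_ord i) _ (nbhsx_ballx _ _ r0).
  have [k _ ck] := Gc _ Gq; exists k.
  by apply: (ball_triangle ck); exact: ball_sym.
have [k Hk] := choice ex.
have near4 i j : k i = k j -> ball (x i, f (x i)) (rho + rho + (rho + rho)) (x j, f (x j)).
  move=> kij; apply: (@ball_triangle _ _ (c (k i))); first exact/ball_sym/Hk.
  by rewrite kij; exact: Hk.
have rho4 : rho + rho + (rho + rho) = 4 * rho by ring.
rewrite rho4 in near4.
have -> : expR (- 8) ^+ d * n%:R ^+ 2 <= m%:R * pair_energy f x n rho =
   (n%:R ^+ 2 <= m%:R * (pair_energy f x n rho / expR (- 8) ^+ d)).
  by rewrite mulrA ler_pdivlMr ?exprn_gt0 ?expR_gt0// mulrC.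
apply: (le_trans (sqr_card_le_fibre_pairs k)).
rewrite ler_wpM2l// ler_pdivlMr ?exprn_gt0 ?expR_gt0// mulr_suml.
apply: ler_sum => i _; rewrite mulr_suml [leRHS]big_mkcond/=; apply: ler_sum => j _.
have [kij|_] := eqVneq (k i) (k j); last first.
  rewrite mul0r; case: ifP => // _; apply: prodr_ge0 => l _; exact: gauss_kernel_ge0.
have [/= b1 [_ b2]] := near4 _ _ kij.
rewrite (ltW b1) mul1r -[d in _ ^+ d]card_ord -prodr_const.
apply: ler_prod => l _; rewrite expR_ge0/= gauss_kernel_ge//.
rewrite normrM normfV (gtr0_norm r0) ler_pdivrMr//.
by apply: ltW; exact: b2 ord0 l.
Qed.

End pair_energy.

(** * Expected energy along fractional Brownian motion *)

Section expected_energy.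
Context {R : realType} dT (T : measurableType dT) (P : probability T R).
Variables (d : nat) (alpha : R) (X : R -> T -> 'rV[R]_d).
Hypotheses (d0 : (0 < d)%N) (alpha0 : 0 < alpha) (ad1 : alpha * d%:R < 1).
Hypothesis HX : is_fbm P alpha X.

Lemma measurable_fbm u i : measurable_fun setT (fun w => X u w ord0 i).
Proof.
have [+ _] := HX.1 1%N (fun=> u) (fun=> i) (fun=> 1).
by under eq_fun do rewrite big_ord1 mul1r.
Qed.

Lemma measurable_prod_gauss_kernel (s t rho : R) : measurable_fun setT
  (fun w => \prod_(l < d) gauss_kernel ((X s w ord0 l - X t w ord0 l) / rho)).
Proof.
apply: measurable_prod => l _.
apply: measurableT_comp; first exact: measurable_gauss_kernel.
apply: measurable_funM => //; apply: measurable_funB; exact: measurable_fbm.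
Qed.

Lemma integral_prod_gauss_kernel (s t rho : R) :
  (\int[P]_w (\prod_(l < d) gauss_kernel ((X s w ord0 l - X t w ord0 l) / rho))%:E =
  ((Num.sqrt (1 + `|s - t| `^ (2 * alpha) / rho ^+ 2) ^+ d)^-1)%:E)%E.
Proof.
rewrite -(expectation_gauss_kernel_fbm s t rho d0 (lt0r_neq0 alpha0) HX).
rewrite /Rintegral fineK//; apply: integrable_fin_num => //.
apply: (bounded_prob_integrable P (M := 1) (measurable_prod_gauss_kernel s t rho)).
move=> w; rewrite ger0_norm; last by apply: prodr_ge0 => l _; exact: gauss_kernel_ge0.
apply: prodr_ile1 => l _; rewrite gauss_kernel_ge0 gauss_kernel_le1//.
Qed.

Lemma measurable_pair_energy (x : nat -> R) n rho :
  measurable_fun setT (fun w => pair_energy (X ^~ w) x n rho).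
Proof.
apply: measurable_sum => i; rewrite [X in measurable_fun _ X](_ : _ = fun w =>
    \sum_(j < n) if `|x i - x j| <= 4 * rho then
      \prod_(l < d) gauss_kernel ((X (x i) w ord0 l - X (x j) w ord0 l) / rho) else 0);
  last by apply/funext => w; rewrite [LHS]big_mkcond.
apply: measurable_sum => j; case: (_ <= 4 * rho); last exact: measurable_cst.
exact: measurable_prod_gauss_kernel.
Qed.

Lemma pair_energy_ge0 (f : R -> 'rV[R]_d) (x : nat -> R) n rho : 0 <= pair_energy f x n rho.
Proof.
apply: sumr_ge0 => i _; apply: sumr_ge0 => j _; apply: prodr_ge0 => l _.
exact: gauss_kernel_ge0.
Qed.

(** For each [i], the diagonal contributes [1] and the other indices at most [8 / (1 - alpha d)], by
    the small ball bound and the energy of separated times. *)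
Lemma expected_pair_energy_le (x : nat -> R) (r g theta : R) n :
  0 < r < 1 -> 0 < theta ->
  (forall j k, (j < k < n)%N -> r * (k - j)%:R <= x k - x j) ->
  n%:R <= r `^ (- g) ->
  alpha * d%:R + g * (1 - alpha * d%:R) <= theta * d%:R \/
  1 <= theta * (d%:R + 1 - alpha * d%:R) ->
  (\int[P]_w (pair_energy (X ^~ w) x n (r `^ theta))%:E <=
   (n%:R * (1 + 8 / (1 - alpha * d%:R)))%:E)%E.
Proof.
move=> r01 t0 xr ng H; have /andP[r0 r1] := r01.
set rho := r `^ theta; have rho0 : 0 < rho by rewrite powR_gt0.
have a01 : 0 < alpha * d%:R < 1 by rewrite mulr_gt0 ?ltr0n.
pose K i j w := \prod_(l < d) gauss_kernel ((X (x i) w ord0 l - X (x j) w ord0 l) / rho).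
have K0 i j w : (0 <= (K i j w)%:E)%E.
  by rewrite lee_fin; apply: prodr_ge0 => l _; exact: gauss_kernel_ge0.
have mK i j : measurable_fun setT (EFin \o K i j).
  by apply/measurable_EFinP; exact: measurable_prod_gauss_kernel.
under eq_integral do rewrite /pair_energy -sumEFin.
rewrite ge0_integral_sum//=; last 2 first.
- move=> i; apply/measurable_EFinP; rewrite [X in measurable_fun _ X](_ : _ = fun w =>
      \sum_(j < n) if `|x i - x j| <= 4 * rho then K i j w else 0);
    last by apply/funext => w; rewrite [LHS]big_mkcond.
  apply: measurable_sum => j; case: (_ <= 4 * rho); last exact: measurable_cst.
  exact: measurable_prod_gauss_kernel.
- move=> i w _; rewrite lee_fin; apply: sumr_ge0 => j _; apply: prodr_ge0 => l _.
  exact: gauss_kernel_ge0.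
apply: (@le_trans _ _ (\sum_(i < n) (1 + 8 / (1 - alpha * d%:R))%:E)%E); last first.
  rewrite sumEFin sumr_const card_ord. by rewrite [n%:R * _]mulr_natl.
apply: lee_sum => i _.
rewrite (eq_integral (fun w => \sum_(j < n)
    (if (`|x i - x j| <= 4 * rho)%R then (K i j w)%:E else 0))%E); last first.
  by move=> w _; rewrite -sumEFin [LHS]big_mkcond.
rewrite ge0_integral_sum//=; last 2 first.
- by move=> j; case: (_ <= 4 * rho); [exact: mK|exact: measurable_cst].
- by move=> j w _; case: ifP => _ //; exact: K0.
rewrite (_ : (\sum_(j < n) _)%E = (\sum_(j < n | (`|x i - x j| <= 4 * rho)%R)
    ((Num.sqrt (1 + `|x i - x j| `^ (2 * alpha) / rho ^+ 2) ^+ d)^-1)%:E)%E); last first.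
  rewrite [RHS]big_mkcond/=; apply: eq_bigr => j _; case: (_ <= 4 * rho).
    exact: integral_prod_gauss_kernel.
  by rewrite integral0.
rewrite sumEFin lee_fin (bigD1 i)/=; last by rewrite subrr normr0 mulr_ge0// ltW.
apply: lerD.
  rewrite subrr normr0 powR0 ?mulf_neq0 ?gt_eqF// mul0r addr0 sqrtr1 expr1n invr1//.
apply: le_trans (separated_energy_le i r01 a01 t0 xr ng H).
rewrite (eq_bigl (fun j => (j != i) && (`|x i - x j| <= 4 * rho))); last first.
  by move=> j; rewrite andbC.
apply: ler_sum => j /andP[ji _]; apply: small_ball_bound => //.
rewrite normr_gt0 subr_eq0; apply/eqP => xij.
have lt0 (k l : nat) : (k < l < n)%N -> x k <> x l.
  move=> kl e; have := xr _ _ kl; rewrite e subrr leNgt mulr_gt0//.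
  by rewrite ltr0n subn_gt0; case/andP: kl.
case: (ltngtP i j) => ij.
- by apply: (lt0 i j) => //; rewrite ij/=.
- by apply: (lt0 j i) => //; rewrite ij/=.
- by rewrite (val_inj ij) eqxx in ji.
Qed.

End expected_energy.


(** * Scales and exceptional events *)

Section scales.
Context {R : realType}.

Lemma inv_nat_small (y : R) : 0 < y -> exists K, forall k, (K <= k)%N -> k.+2%:R^-1 < y.
Proof.
move=> y0; exists (Num.truncn y^-1) => k Kk.
rewrite -[ltRHS]invrK ltf_pV2 ?posrE ?invr_gt0//.
apply: (lt_le_trans (truncnS_gt _)); rewrite ler_nat ltnS ltnW//.
Qed.

Lemma powR_lt_of_lt (x y p : R) : 0 < p -> 0 <= x -> 0 < y -> x < y `^ (p^-1) -> x `^ p < y.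
Proof.
move=> p0 x0 y0 xy.
have -> : y = (y `^ p^-1) `^ p by rewrite -powRrM mulVf ?gt_eqF// powRr1// ltW.
by apply: gt0_ltr_powR => //; rewrite nnegrE ?powR_ge0.
Qed.

Lemma markov_ratio (e n p q : R) : e != 0 -> n != 0 -> p != 0 ->
  (e * n / p / 2)^-1 * (n * q) = 2 * q / e * p.
Proof. by move=> e0 n0 p0; field; rewrite e0 n0 p0. Qed.

(** The two energy bounds give [2 n <= m r^-eps], which is compared with [r^-g <= 2 n]. *)
Lemma energy_to_count (e n r eps g m Z : R) : 0 < e -> 0 < n -> 0 < r -> 0 <= m ->
  r `^ (- g) <= 2 * n ->
  e * n ^+ 2 <= m * Z -> Z <= e * n * r `^ (- eps) / 2 -> r `^ (- (g - eps)) <= m.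
Proof.
move=> e0 n0 r0 m0 gn H1 H2.
have p0 : 0 < r `^ (- eps) by rewrite powR_gt0.
have -> : r `^ (- (g - eps)) = r `^ (- g) / r `^ (- eps).
  by rewrite -powRB ?(gt_eqF r0) ?implybT// opprB opprK addrC.
rewrite ler_pdivrMr//; apply: (le_trans gn).
have H3 : e * n ^+ 2 <= m * (e * n * r `^ (- eps) / 2).
  by apply: (le_trans H1); exact: ler_wpM2l.
have en0 : 0 < e * n by rewrite mulr_gt0.
rewrite -(@ler_pM2l _ (e * n))//.
move: H3; move: (r `^ (- eps)) => q; nra.
Qed.

End scales.

Section almost_sure.
Context {R : realType} dT (T : measurableType dT) (P : probability T R).

(** The event that every [B k] with [k >= m] occurs lies in each of them, so its probability is
    below every positive number. Infinitely many good scales suffice for an upper box dimension. *)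
Lemma ae_frequently_notin (B : nat -> set T) (u : nat -> R) :
  (forall k, measurable (B k)) -> (forall k, P (B k) <= (u k)%:E)%E ->
  (forall e, 0 < e -> exists K, forall k, (K <= k)%N -> u k < e) ->
  {ae P, forall w, forall m, exists2 k, (m <= k)%N & ~ B k w}.
Proof.
move=> mB Bu u0; apply: ae_foralln => m.
pose N := \bigcap_(k in [set k | (m <= k)%N]) B k.
have mN : measurable N by apply: bigcap_measurable => //; exists m => /=.
exists N; split => //.
  apply/eqP; rewrite eq_le measure_ge0 andbT; apply/lee_addgt0Pr => e e0.
  have [K HK] := u0 _ e0; rewrite add0e.
  have := HK (maxn m K) (leq_maxr _ _) => ue.
  apply: (@le_trans _ _ (P (B (maxn m K)))).
    by apply: le_measure; rewrite ?inE// => w; apply; exact: leq_maxl.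
  by apply: (le_trans (Bu _)); rewrite lee_fin ltW.
by move=> w /= /forall2NP H k mk; have [|/contrapT] := H k.
Qed.

End almost_sure.

(** * Upper box dimension of the graph *)

Section core.
Context {R : realType} dT (T : measurableType dT) (P : probability T R).
Variables (d : nat) (alpha : R) (X : R -> T -> 'rV[R]_d).
Hypotheses (d0 : (0 < d)%N) (alpha0 : 0 < alpha) (ad1 : alpha * d%:R < 1).
Hypothesis HX : is_fbm P alpha X.
Local Notation C := (2 * (1 + 8 / (1 - alpha * d%:R)) / expR (- 8) ^+ d).

(** The bad event is a large energy of a fixed finite set of times. It does not involve [G], so that
    [G] may later depend on the sample point. *)
Lemma graph_covering_event (E : set R) (r g eps theta : R) :
  0 < r < 1 -> 0 <= g -> 0 < theta ->
  alpha * d%:R + g * (1 - alpha * d%:R) <= theta * d%:R \/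
  1 <= theta * (d%:R + 1 - alpha * d%:R) ->
  (g%:E < box_ratio E r)%E ->
  exists B : set T, [/\ measurable B, (P B <= (C * r `^ eps)%:E)%E &
    forall w, ~ B w -> forall G : set (R * 'rV[R]_d),
      graph_on X w E `<=` closure G ->
      ((r `^ (- (g - eps)))%:E <= covering_number G (r `^ theta))%E].
Proof.
move=> r01 g0 t0 H gE; have /andP[r0 r1] := r01.
have [x [n [ng gn n0 xE xr]]] := box_ratio_gt_separated r01 g0 gE.
have np : 0 < n%:R :> R by rewrite ltr0n.
set rho := r `^ theta; have rho0 : 0 < rho by rewrite powR_gt0.
set e := expR (- 8) ^+ d; have e0 : 0 < e by rewrite exprn_gt0// expR_gt0.
(* At this level Markov's inequality costs [C r^eps], while [n] is lost only up to [r^-eps] in the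
   count. *)
pose t := e * n%:R * r `^ (- eps) / 2.
have tp : 0 < t by rewrite divr_gt0// !mulr_gt0// powR_gt0.
pose Z w := pair_energy (X ^~ w) x n rho.
have mZ : measurable_fun setT (EFin \o Z).
  by apply/measurable_EFinP; apply: measurable_pair_energy HX _ _ _.
have Z0 w : 0 <= Z w by exact: pair_energy_ge0.
pose B := setT `&` [set w | (t%:E <= `|(EFin \o Z) w|)%E].
exists B; split.
- by apply: emeasurable_fun_c_infty => //; exact: measurableT_comp.
- have := le_integral_abse P measurableT mZ tp; rewrite -/B.
  under eq_integral do rewrite gee0_abs ?lee_fin//.
  move=> /le_trans /(_ (expected_pair_energy_le d0 alpha0 ad1 HX r01 t0 xr ng H)).
  rewrite -lee_pdivlMl// -EFinM => /le_trans; apply.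
  rewrite lee_fin /t le_eqVlt; apply/orP; left; apply/eqP.
  by rewrite powRN; apply: markov_ratio; rewrite gt_eqF// powR_gt0.
- move=> w nB G EG.
  have Zt : Z w <= t.
    apply: ltW; rewrite ltNge; apply/negP => tZ; apply: nB; split => //=.
    by rewrite lee_fin ger0_norm.
  apply/le_ereal_inf_tmp => _ [m [c Gc] <-]; rewrite lee_fin.
  apply: (energy_to_count (Z := Z w) e0 np r0 _ gn _ Zt) => //.
  apply: (pair_energy_ge rho0 _ Gc) => i ni; apply: EG; exists (x i) => //.
  exact: xE.
Qed.

(** Scales [r k] tending to [0] at which [E] has large box ratio are fixed beforehand; almost
    surely, infinitely many avoid their bad events. *)
Lemma ae_upper_box_dim_graph_ge (E : set R) (g eps theta : R) :
  0 <= g -> 0 < theta -> 0 < eps ->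
  alpha * d%:R + g * (1 - alpha * d%:R) <= theta * d%:R \/
  1 <= theta * (d%:R + 1 - alpha * d%:R) ->
  (g%:E < upper_box_dim E)%E ->
  {ae P, forall w, forall G : set (R * 'rV[R]_d),
    graph_on X w E `<=` closure G -> (((g - eps) / theta)%:E <= upper_box_dim G)%E}.
Proof.
move=> g0 t0 eps0 H gE.
have ex (k : nat) : exists rB : R * set T, [/\ 0 < rB.1 < k.+2%:R^-1, measurable rB.2,
    (P rB.2 <= (C * rB.1 `^ eps)%:E)%E &
    forall w, ~ rB.2 w -> forall G : set (R * 'rV[R]_d),
      graph_on X w E `<=` closure G ->
      ((rB.1 `^ (- (g - eps)))%:E <= covering_number G (rB.1 `^ theta))%E].
  have k1 : 0 < (k.+2%:R^-1 : R) < 1 by rewrite invr_gt0 ltr0n invf_lt1// ltr1n.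
  have [r /andP[r0 rk] gr] := upper_box_dim_gt gE k1.
  have r01 : 0 < r < 1 by rewrite r0 (lt_trans rk)//; case/andP: k1.
  have [B [mB PB HB]] := graph_covering_event eps r01 g0 t0 H gr.
  by exists (r, B); split => //=; rewrite r0.
have [rB HrB] := choice ex.
pose r k := (rB k).1; pose B k := (rB k).2.
have r0 k : 0 < r k by have [/andP[]] := HrB k.
have rlt k : r k < k.+2%:R^-1 by have [/andP[]] := HrB k.
have C0 : 0 < C.
  by rewrite divr_gt0 ?exprn_gt0 ?expR_gt0// mulr_gt0// ltr_pwDl// divr_ge0// subr_ge0 ltW.
apply: filterS (@ae_frequently_notin _ _ _ P B (fun k => C * r k `^ eps) _ _ _).
- move=> w Hw G EG; apply: upper_box_dim_ge => delta /andP[de0 de1].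
  have [K HK] := inv_nat_small (powR_gt0 theta^-1 de0).
  have [k Kk nBk] := Hw K.
  have rhod : r k `^ theta < delta.
    by apply: powR_lt_of_lt (ltW (r0 k)) de0 _ => //; exact: lt_trans (rlt k) (HK k Kk).
  exists (r k `^ theta); first by rewrite powR_gt0//= rhod.
  apply: box_ratio_ge; first by rewrite powR_gt0//= (lt_trans rhod).
  (* In terms of [rho = r^theta], the count [r^-(g - eps)] is [rho^-((g - eps) / theta)]. *)
  rewrite -powRrM mulrN mulrC divfK ?gt_eqF//.
  by have [_ _ _ /(_ _ nBk _ EG)] := HrB k.
- by move=> k; have [] := HrB k.
- by move=> k; have [] := HrB k.
- move=> e e0; have eC0 : 0 < e / C by rewrite divr_gt0.
  have [K HK] := inv_nat_small (powR_gt0 eps^-1 eC0).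
  exists K => k Kk; rewrite mulrC -ltr_pdivlMr//.
  by apply: powR_lt_of_lt (ltW (r0 k)) eC0 _ => //; exact: lt_trans (rlt k) (HK k Kk).
Qed.

End core.


(** * Countable covers by sets of small box dimension *)

Section sigma_box_dim.
Context {R : realType} {V : pseudoMetricType R}.

(** Packing dimension at a fixed threshold [g]: the sets below it are closed under subsets and
    countable unions, as the removal of small cylinders requires. *)
Definition sigma_box_dim_le (g : R) (E : set V) := exists F : nat -> set V,
  E `<=` \bigcup_(i in setT) F i /\ forall i, (upper_box_dim (F i) <= g%:E)%E.

Lemma sigma_box_dim_le_packing_dim g E : sigma_box_dim_le g E -> (packing_dim E <= g%:E)%E.
Proof.
move=> [F [EF Fg]].
apply: (@le_trans _ _ (ereal_sup [set upper_box_dim (F i) | i in setT])).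
  by apply: ereal_inf_lbound; exists F.
by apply: ge_ereal_sup => _ [i _ <-].
Qed.

Lemma sigma_box_dim_leS g (A B : set V) :
  A `<=` B -> sigma_box_dim_le g B -> sigma_box_dim_le g A.
Proof. by move=> AB [F [BF Fg]]; exists F; split => //; exact: subset_trans BF. Qed.

Lemma sigma_box_dim_le_bigcup g (A : nat -> set V) :
  (forall i, sigma_box_dim_le g (A i)) -> sigma_box_dim_le g (\bigcup_i A i).
Proof.
move=> /choice[F HF].
exists (fun n => if unpickle n is Some (i, j) then F i j else F 0 0); split.
  move=> x [i _ Aix]; have [/(_ _ Aix)[j _ Fij] _] := HF i.
  by exists (pickle (i, j)) => //; rewrite pickleK.
move=> n; case: unpickle => [[i j]|]; first by have [_] := HF i.
by have [_] := HF 0.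
Qed.

Lemma upper_box_dim_gt_of_nsigma g (E : set V) :
  ~ sigma_box_dim_le g E -> (g%:E < upper_box_dim E)%E.
Proof.
move=> nE; rewrite ltNge; apply/negP => Eg; apply: nE.
by exists (fun=> E); split => // x Ex; exists 0.
Qed.

(** Zero balls cover the empty set, and [ln 0 = 0] by convention. *)
Lemma box_ratio_set0 (r : R) : box_ratio (@set0 V) r = 0%E.
Proof.
have c0 : covering_number (@set0 V) r = 0%E.
  apply/eqP; rewrite eq_le covering_number_ge0 andbT.
  apply: ereal_inf_lbound; exists 0 => //.
  have c : 'I_0 -> V by case.
  by exists c.
by rewrite /box_ratio c0 /= ln0// mul0r.
Qed.

Lemma sigma_box_dim_le_set0 (g : R) : 0 <= g -> sigma_box_dim_le g (@set0 V).
Proof.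
move=> g0; exists (fun=> set0); split => // _.
apply: (@le_trans _ _ (ereal_sup [set box_ratio (@set0 V) r | r in `]0, 2^-1[ ])).
  apply: ereal_inf_lbound; exists 2^-1 => //=.
  by rewrite in_itv/= invr_gt0 invf_lt1// ltr0n ltr1n.
by apply: ge_ereal_sup => _ [r _ <-]; rewrite box_ratio_set0 lee_fin.
Qed.

Lemma box_ratio_ge0 (E : set V) (r : R) : 0 < r < 1 -> (0 <= box_ratio E r)%E.
Proof.
move=> r01; have [->|/set0P[x Ex]] := eqVneq E set0.
  by rewrite box_ratio_set0.
apply: box_ratio_ge => //; rewrite oppr0 powRr0.
apply/le_ereal_inf_tmp => _ [n [c Ec] <-]; rewrite lee_fin ler1n.
by case: n c Ec => // c Ec; have [[]] := Ec _ Ex.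
Qed.

Lemma upper_box_dim_ge0 (E : set V) : (0 <= upper_box_dim E)%E.
Proof.
apply: upper_box_dim_ge => delta /andP[d0 d1]; exists (delta / 2).
  by rewrite divr_gt0//= ltr_pdivrMr// ltr_pMr// ltr1n.
apply: box_ratio_ge0; rewrite divr_gt0//= ltr_pdivrMr//.
by rewrite (lt_trans d1)// mul1r ltr1n.
Qed.

Lemma packing_dim_ge0 (E : set V) : (0 <= packing_dim E)%E.
Proof.
apply/le_ereal_inf_tmp => _ [F [_ ->]].
apply: (le_trans (upper_box_dim_ge0 (F 0))).
by apply: ereal_sup_ubound; exists 0.
Qed.

End sigma_box_dim.

(** * Baire category in closed sets of sequences *)

Section baire_space.

Definition agree (n : nat) (x y : nat -> nat) := forall k, (k < n)%N -> x k = y k.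

Lemma agree_leq n m x y : (n <= m)%N -> agree m x y -> agree n x y.
Proof. by move=> nm xy k kn; apply: xy; exact: leq_trans nm. Qed.

(** If no [B i] were dense in a piece of [C], nested cylinders could be chosen to avoid [B 0],
    [B 1], and so on; their limit would be a point of [C] in no [B i]. *)
Lemma baire_category (C : set (nat -> nat)) (B : nat -> set (nat -> nat)) :
  (forall x, (forall n, exists2 y, C y & agree n y x) -> C x) ->
  C !=set0 -> C `<=` \bigcup_i B i ->
  exists i x n, C x /\ forall x', C x' -> agree n x' x ->
    forall m, exists y, [/\ C y, agree m y x' & B i y].
Proof.
move=> closedC [x0 Cx0] CB; apply: contrapT => H.
have step (i : nat) (s : (nat -> nat) * nat) : exists s' : (nat -> nat) * nat, C s.1 ->
    [/\ C s'.1, (s.2 < s'.2)%N, agree s.2 s'.1 s.1 &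
      forall y, C y -> agree s'.2 y s'.1 -> ~ B i y].
  have [Cx|nCx] := pselect (C s.1); last by exists s => /nCx.
  apply: contrapT => H'; apply: H; exists i, s.1, s.2; split => // x' Cx' ax' m.
  (* The new length exceeds the old one, so that the prefixes determine a limit. *)
  apply: contrapT => H2; apply: H'; exists (x', maxn m s.2.+1) => _; split => //=.
    exact: leq_maxr.
  move=> y Cy ay By; apply: H2; exists y; split => //.
  by apply: agree_leq ay; exact: leq_maxl.
have [next Hnext] := choice (fun p => step p.1 p.2).
pose st := fix st i := if i is j.+1 then next (j, st j) else (x0, 0%N).
have Cst i : C (st i).1.
  by elim: i => [//|i IH] /=; have [] := Hnext (i, _) IH.
have lt_st i : ((st i).2 < (st i.+1).2)%N by have [] := Hnext (i, _) (Cst i).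
have ge_st i : (i <= (st i).2)%N.
  by elim: i => // i IH; exact: leq_ltn_trans (lt_st i).
have le_st i j : (i <= j)%N -> ((st i).2 <= (st j).2)%N.
  move=> /subnK <-; elim: (j - i)%N => // k IH.
  by apply: (leq_trans IH); rewrite addSn ltnW.
have ag i j : (i <= j)%N -> agree (st i).2 (st j).1 (st i).1.
  move=> /subnK <-; elim: (j - i)%N => // k IH p pi; rewrite addSn -IH//.
  have [_ _ + _] := Hnext ((k + i)%N, _) (Cst (k + i)%N); apply.
  by apply: (leq_trans pi); apply: le_st; rewrite leq_addl.
(* Coordinate [k] is settled at stage [k + 1], since the prefix there has length at least
   [k + 1]. *)
pose z k := (st k.+1).1 k.
have zag i : agree (st i).2 z (st i).1.
  move=> k ki; rewrite /z; have [ik|ki'] := leqP i k.+1; first exact: ag.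
  by rewrite (ag k.+1 i (ltnW ki'))//; exact: ge_st.
have Cz : C z.
  apply: closedC => n; exists (st n).1 => // k kn.
  by rewrite (zag n)//; exact: leq_trans kn (ge_st n).
have [i _ Biz] := CB _ Cz.
have [_ _ _ /(_ z Cz)] := Hnext (i, _) (Cst i); apply => //.
exact: zag i.+1.
Qed.

End baire_space.

(** * The kernel of a parametrised analytic set *)

Section analytic.
Context {R : realType}.
Variables (f : (nat -> nat) -> R) (g : R).

(** Indexing by finite sequences makes the cylinders countable. *)
Definition cylinder (s : seq nat) : set (nat -> nat) :=
  [set x | agree (size s) x (nth 0 s)].

Lemma cylinder_mkseq x n : cylinder (mkseq x n) = [set y | agree n y x].
Proof.
apply/seteqP; split => y; rewrite /cylinder /agree /= size_mkseq => yx k kn.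
  by rewrite yx ?nth_mkseq.
by rewrite nth_mkseq ?yx.
Qed.

(* Closed, and each nonempty relatively open piece still has an image that is not
   covered by countably many sets of upper box dimension at most [g]: this
   replaces the choice of a compact subset of the analytic set. *)
Definition kernel_set : set (nat -> nat) :=
  [set x | forall s, cylinder s x -> ~ sigma_box_dim_le g (f @` cylinder s)].

Lemma kernel_set_closed x : (forall n, exists2 y, kernel_set y & agree n y x) -> kernel_set x.
Proof.
move=> H s sx; have [y Cy yx] := H (size s); apply: Cy => k ks.
by rewrite yx ?sx.
Qed.

(** The points outside the kernel lie in countably many cylinders with small images; were the kernel
    part small too, so would be the whole image. *)
Lemma kernel_cylinder_nsmall s : ~ sigma_box_dim_le g (f @` cylinder s) ->
  ~ sigma_box_dim_le g (f @` (cylinder s `&` kernel_set)).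
Proof.
move=> ns sC; apply: ns.
(* Small images sit at the codes of their cylinders; every other index is filled with the kernel
   part. *)
pose A n := if unpickle n is Some t then
  (if `[< sigma_box_dim_le g (f @` cylinder t) >] then f @` cylinder t
   else f @` (cylinder s `&` kernel_set)) else f @` (cylinder s `&` kernel_set).
apply: (@sigma_box_dim_leS _ _ _ _ (\bigcup_n A n)); last first.
  apply: sigma_box_dim_le_bigcup => n; rewrite /A; case: unpickle => // t.
  by case: ifPn => // /asboolP.
move=> _ [x sx <-]; have [Cx|nCx] := pselect (kernel_set x).
  exists (pickle s) => //; rewrite /A pickleK; case: ifP => _; exists x => //.
move: nCx => /existsNP[t /not_implyP[tx /contrapT st]].
by exists (pickle t) => //; rewrite /A pickleK asboolT//; exists x.
Qed.

Lemma kernel_point_nsmall s x : cylinder s x -> kernel_set x ->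
  ~ sigma_box_dim_le g (f @` (cylinder s `&` kernel_set)).
Proof. by move=> sx Cx; apply: kernel_cylinder_nsmall; exact: Cx. Qed.

Lemma kernel_set_nonempty : ~ sigma_box_dim_le g (range f) -> kernel_set !=set0.
Proof.
move=> nA; apply/set0P/eqP => C0.
have c0 : cylinder [::] = setT by apply/seteqP; split.
have := @kernel_cylinder_nsmall [::]; rewrite c0 => /(_ nA).
rewrite C0 setI0 image_set0; apply.
(* A point outside the kernel supplies a small image, of which the empty set is a subset. *)
have : ~ kernel_set (fun=> 0) by rewrite C0.
move=> /existsNP[t /not_implyP[_ /contrapT]].
exact: sigma_box_dim_leS.
Qed.

End analytic.


(** * Choice of exponents *)

Section exponents.
Context {R : realType}.

(** [g] is the midpoint of [b theta] and [beta], and [eps] is half their distance. *)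
Lemma exponent_choice (beta b theta : R) : 0 <= beta -> 0 <= b -> 0 < theta ->
  b < beta / theta -> exists g eps, [/\ 0 <= g, g < beta, 0 < eps & (g - eps) / theta = b].
Proof.
move=> beta0 b0 t0; rewrite ltr_pdivlMr// => bt.
have bt0 : 0 <= b * theta by rewrite mulr_ge0// ltW.
exists ((beta + b * theta) / 2), ((beta - b * theta) / 2); split; [lra|lra|lra|].
by field; rewrite gt_eqF.
Qed.

(** This [theta] makes the first energy condition an equality at [g = beta]. *)
Lemma theta_imageE (a beta d : R) : 0 < a < 1 -> 0 < d -> 0 <= beta ->
  let theta := (a + beta * (1 - a)) / d in
  0 < theta /\ beta * d / (a + beta * (1 - a)) = beta / theta.
Proof.
move=> /andP[a0 a1] d0 b0 theta.
have p0 : 0 < a + beta * (1 - a) by rewrite ltr_wpDr// mulr_ge0// subr_ge0 ltW.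
by rewrite /theta; split; [exact: divr_gt0|rewrite invf_div mulrA].
Qed.

Lemma theta_image_le (a beta g d : R) : a < 1 -> 0 < d -> g < beta ->
  a + g * (1 - a) <= (a + beta * (1 - a)) / d * d.
Proof.
by move=> a1 d0 gb; rewrite divfK ?gt_eqF// lerD2l ler_wpM2r ?subr_ge0 ?(ltW a1)// ltW.
Qed.

End exponents.

(** * Packing dimension of the graph *)

Section packing_graph.
Context {R : realType} dT (T : measurableType dT) (P : probability T R).
Variables (d : nat) (alpha : R) (X : R -> T -> 'rV[R]_d).
Hypotheses (d0 : (0 < d)%N) (alpha0 : 0 < alpha) (ad1 : alpha * d%:R < 1).
Hypothesis HX : is_fbm P alpha X.

(** Continuity of [f] and of the path carries density in the Baire space over to the graph. *)
Lemma graph_sub_closure (f : (nat -> nat) -> R) (w : T)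
    (G : set (R * 'rV[R]_d)) (D : set (nat -> nat)) :
  baire_continuous f -> continuous (fun t => X t w) ->
  (forall x, D x -> forall m, exists2 y, agree m y x & G (f y, X (f y) w)) ->
  graph_on X w (f @` D) `<=` closure G.
Proof.
move=> fc Xc H _ [_ [x Dx <-] <-] U nU.
have /nbhs_ballP[e /= e0 He] := nU.
have /nbhs_ballP[e' /= e'0 He'] := Xc (f x) _ (nbhsx_ballx _ _ e0).
have me : 0 < Num.min e e' by rewrite lt_min e0.
have [m Hm] := fc x _ me; have [y yx Gy] := H x Dx m.
have /andP[fe fe'] : (`|f x - f y| < e) && (`|f x - f y| < e').
  by rewrite -lt_min distrC; exact: Hm.
by exists (f y, X (f y) w); split => //; apply: He; split => //=; exact: He'.
Qed.

(** One almost sure event serves all cylinders; on it, the covers of the graph are treated path by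
    path with the category theorem. *)
Lemma ae_packing_dim_graph_ge (A : set R) (g eps theta : R) :
  0 <= g -> 0 < theta -> 0 < eps ->
  alpha * d%:R + g * (1 - alpha * d%:R) <= theta * d%:R \/
  1 <= theta * (d%:R + 1 - alpha * d%:R) ->
  analytic_set A -> (g%:E < packing_dim A)%E ->
  {ae P, forall w, (((g - eps) / theta)%:E <= packing_dim (graph_on X w A))%E}.
Proof.
move=> g0 t0 eps0 H anA gA.
have nA : ~ sigma_box_dim_le g A.
  by move=> /sigma_box_dim_le_packing_dim; rewrite leNgt gA.
case: anA => [A0|[f [fc fA]]].
  by case: nA; rewrite A0; exact: sigma_box_dim_le_set0.
rewrite -fA in nA *.
pose C := kernel_set f g.
(* Quantifying over codes [n] makes this a countable intersection of almost sure events. *)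
have ae_cyl : {ae P, forall w, forall n, forall s, unpickle n = Some s ->
    (cylinder s `&` C !=set0) -> forall G : set (R * 'rV[R]_d),
    graph_on X w (f @` (cylinder s `&` C)) `<=` closure G ->
    (((g - eps) / theta)%:E <= upper_box_dim G)%E}.
  apply: ae_foralln => n.
  case: unpickle => [s|]; last by apply: aeW.
  have [[x [sx Cx]]|ne] := pselect (cylinder s `&` C !=set0); last first.
    by apply: aeW => w _ [<-] /ne.
  have gs := upper_box_dim_gt_of_nsigma (kernel_point_nsmall sx Cx).
  apply: filterS (ae_upper_box_dim_graph_ge d0 alpha0 ad1 HX g0 t0 eps0 H gs) => w Hw.
  by move=> _ [<-] _; exact: Hw.
have [_ [_ aec]] := HX.
apply: filterS2 ae_cyl aec => w Hw Xc.
apply/le_ereal_inf_tmp => _ [F [AF ->]].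
(* The cover is pulled back to the Baire space, where one member is dense in a cylinder of [C]. *)
have [||i [x [n [Cx Hx]]]] := @baire_category C (fun i => [set y | F i (f y, X (f y) w)]) (@kernel_set_closed _ f g).
- exact: kernel_set_nonempty.
- move=> y _; have [|i _ Fi] := AF (f y, X (f y) w); first by exists (f y) => //; exists y.
  by exists i.
apply: (@le_trans _ _ (upper_box_dim (F i))); last first.
  by apply: ereal_sup_ubound; exists i.
apply: (Hw _ (mkseq x n) (pickleK _)).
  by exists x; split => //; rewrite cylinder_mkseq.
apply: (graph_sub_closure fc) => // y []; rewrite cylinder_mkseq => yx Cy m.
by have [z [_ zy Fz]] := Hx _ Cy yx m; exists z.
Qed.

End packing_graph.

Unset Implicit Arguments.

Theorem theorem1p15 (R : realType) (dT : measure_display) (T : measurableType dT)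
  (P : probability T R) (d : nat) (alpha beta : R)
  (X : R -> T -> 'rV[R]_d) (A : set R) :
  (0 < d)%N -> 0 < alpha -> alpha < 1 -> alpha * d%:R < 1 ->
  is_fbm P alpha X ->
  analytic_set A -> packing_dim A = beta%:E ->
  {ae P, forall w,
    (Num.max (beta * d%:R / (alpha * d%:R + beta * (1 - alpha * d%:R)))
             (beta * (d%:R + 1 - alpha * d%:R)))%:E
    <= packing_dim (graph_on X w A)}%E.
Proof.
move=> d0 alpha0 _ ad1 HX anA Abeta.
have beta0 : 0 <= beta by rewrite -lee_fin -Abeta packing_dim_ge0.
have dp : 0 < d%:R :> R by rewrite ltr0n.
have a01 : 0 < alpha * d%:R < 1 by rewrite mulr_gt0.
(* Each regime reaches every level strictly below [beta / theta]. *)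
have below b theta : 0 < theta -> b < beta / theta ->
    (forall g, g < beta -> alpha * d%:R + g * (1 - alpha * d%:R) <= theta * d%:R) \/
    1 <= theta * (d%:R + 1 - alpha * d%:R) ->
    {ae P, forall w, (b%:E <= packing_dim (graph_on X w A))%E}.
  move=> t0 bt H; have [b0|b0] := leP 0 b; last first.
    apply: aeW => w; apply: le_trans (packing_dim_ge0 _).
    by rewrite lee_fin ltW.
  have [g [eps [g0 gb eps0 <-]]] := exponent_choice beta0 b0 t0 bt.
  have gA : (g%:E < packing_dim A)%E by rewrite Abeta lte_fin.
  refine (ae_packing_dim_graph_ge d0 alpha0 ad1 HX g0 t0 eps0 _ anA gA).
  by case: H => [/(_ _ gb)|]; [left|right].
(* The levels [M - 1 / (k + 2)] reach [M] through countably many almost sure events. *)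
have tends M : (forall b, b < M -> {ae P, forall w, (b%:E <= packing_dim (graph_on X w A))%E}) ->
    {ae P, forall w, (M%:E <= packing_dim (graph_on X w A))%E}.
  move=> H; have Hk k : {ae P, forall w, ((M - k.+2%:R^-1)%:E <= packing_dim (graph_on X w A))%E}.
    by apply: H; rewrite gtrBl invr_gt0.
  apply: filterS (ae_foralln Hk) => w Hw; apply/lee_addgt0Pr => e e0.
  have [K HK] := inv_nat_small e0.
  rewrite -leeBlDr// -EFinB; apply: le_trans (Hw K).
  by rewrite lee_fin lerD2l lerN2 ltW// HK.
rewrite maxEle; case: ifP => _; apply: tends => b.
- have q0 : 0 < d%:R + 1 - alpha * d%:R.
    by rewrite -addrA addr_gt0// subr_gt0.
  (* Here [theta = (d + 1 - alpha d)^-1]. *)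
  rewrite -[X in _ < beta * X]invrK => /below; apply; first by rewrite invr_gt0.
  by right; rewrite mulVf// gt_eqF.
- have [t0 ->] := theta_imageE a01 dp beta0.
  move=> /below; apply => //; left => g gb; exact: theta_image_le.
Qed.
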